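(* Let $X$ be a set, let $\Omega$ be a $\sigma$-algebra of subsets of $X$, let $E$ be a $\sigma$-monotone complete partially ordered vector space, and let $\mu:\Omega\to\overline{E^+}$ be an $\overline{E^+}$-valued measure. The quotient map from $\mathcal L^1(X,\Omega,\mu;\mathbb R)$ onto $\mathrm L^1(X,\Omega,\mu;\mathbb R)$ is a $\sigma$-order continuous vector lattice homomorphism, and $\mathrm L^1(X,\Omega,\mu;\mathbb R)$ is a $\sigma$-Dedekind complete vector lattice. The map $I_\mu:\mathrm L^1(X,\Omega,\mu;\mathbb R)\to E$, defined by $I_\mu([f]):=\int_X^{\mathrm o}f\,\mathrm d\mu$ for $[f]\in \mathrm L^1(X,\Omega,\mu;\mathbb R)$, is well defined, linear, strictly positive, and $\sigma$-order continuous. If $E$ is monotone complete and has the countable sup property, then $\mathrm L^1(X,\Omega,\mu;\mathbb R)$ is a Dedekind complete vector lattice with the countable sup property. Moreover, $I_\mu$ is then order continuous.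
   Context: All vector spaces are real. A partially ordered vector space $E$ has a proper positive cone $E^+$ (i.e. $E^+\cap(-E^+)=\{0\}$), not required to be generating. $E$ is $\sigma$-monotone complete (resp. monotone complete) if every increasing sequence (resp. net) in $E$ that is bounded from above has a supremum in $E$; it is $\sigma$-Dedekind complete (resp. Dedekind complete) if every non-empty at most countably infinite subset (resp. every non-empty subset) that is bounded from above has a supremum in $E$. $E$ has the countable sup property if, for every net $(x_\lambda)$ in $E^+$ and $x\in E^+$ with $x_\lambda\uparrow x$, there is an at most countably infinite set of indices $\{\lambda_n:n\ge1\}$ with $x=\sup_{n}x_{\lambda_n}$. (For vector lattices this is equivalent to: every subset with a supremum contains an at most countable subset with the same supremum.) A positive operator (linear map) $T:E\to F$ between partially ordered vector spaces is order continuous (resp. $\sigma$-order continuous) if $Tx_\lambda\downarrow0$ in $F$ whenever a net $x_\lambda\downarrow0$ in $E$ (resp. $Tx_n\downarrow 0$ whenever a sequence $x_n\downarrow0$); it is strictly positive if $\ker T\cap E^+=\{0\}$. Extended space: $\overline{E}=E\cup\{\infty\}$ (disjoint union), ordered by extending the order of $E$ with $x\le\infty$ for all $x\in\overline E$; $\infty+x=x+\infty=\infty$ for all $x\in\overline E$; $r\cdot\infty=\infty$ for real $r>0$ and $0\cdot\infty=0$. $\overline{E^+}=E^+\cup\{\infty\}$. Elements of $E$ are called finite. Measure: an $\overline{E^+}$-valued measure on $\Omega$ is a map $\mu:\Omega\to\overline{E^+}$ with $\mu(\emptyset)=0$ and $\mu\big(\bigcup_{n=1}^\infty\Delta_n\big)=\bigvee_{N=1}^\infty\sum_{n=1}^N\mu(\Delta_n)$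 in $\overline E$ for every pairwise disjoint sequence $(\Delta_n)$ in $\Omega$ with union in $\Omega$. A property holds for almost all $x\in X$ if the set of points where it fails is contained in some $\Delta\in\Omega$ with $\mu(\Delta)=0$. Order integral: for $\varphi=\sum_{i=1}^n r_i\chi_{\Delta_i}$ with $r_i\in[0,\infty)$ and pairwise disjoint $\Delta_i\in\Omega$ (an elementary function), $\int_X^{\mathrm o}\varphi\,\mathrm d\mu:=\sum_{i=1}^n r_i\mu(\Delta_i)\in\overline{E^+}$ (independent of the representation). For measurable $f:X\to[0,\infty]$, choose any sequence of elementary functions $\varphi_n\uparrow f$ pointwise and put $\int_X^{\mathrm o}f\,\mathrm d\mu:=\bigvee_{n=1}^\infty\int_X^{\mathrm o}\varphi_n\,\mathrm d\mu$ in $\overline E$ (independent of the choice of the sequence). Measurable means $\Omega$–Borel measurable. $\mathcal L^1(X,\Omega,\mu;\mathbb R)$ is the set of measurable $f:X\to\mathbb R$ with $\int_X^{\mathrm o}|f|\,\mathrm d\mu$ finite, a vector lattice under the pointwise order; for such $f$, write $f=f_1-f_2$ with $f_1,f_2\ge0$ in $\mathcal L^1(X,\Omega,\mu;\mathbb R)$ and put $\int_X^{\mathrm o}f\,\mathrm d\mu:=\int_X^{\mathrm o}f_1\,\mathrm d\mu-\int_X^{\mathrm o}f_2\,\mathrm d\mu\in E$ (independent of the choice). $\mathcal N(X,\Omega,\mu;\mathbb R)$ is the set of measurable $f:X\to\mathbb R$ with $f(x)=0$ for almost all $x\in X$; it is an order ideal of $\mathcal L^1(X,\Omega,\mu;\mathbb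 R)$. $\mathrm L^1(X,\Omega,\mu;\mathbb R):=\mathcal L^1(X,\Omega,\mu;\mathbb R)/\mathcal N(X,\Omega,\mu;\mathbb R)$ is the quotient vector lattice, whose positive cone is the image of the positive cone of $\mathcal L^1(X,\Omega,\mu;\mathbb R)$; $[f]$ denotes the class of $f$. *)

(* Defs.v *)
From HB Require Import structures.
From mathcomp Require Import all_boot all_order all_algebra.
From mathcomp Require Import generic_quotient ring_quotient.
From mathcomp Require Import all_classical all_reals all_analysis measurable_realfun.
From mathcomp Require Import lra.

Set Implicit Arguments.
Unset Strict Implicit.
Unset Printing Implicit Defensive.

Import Order.TTheory GRing.Theory Num.Theory.
Import numFieldNormedType.Exports.
Import HBNNSimple.

Local Open Scope classical_set_scope.
Local Open Scope ring_scope.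
Local Open Scope quotient_scope.

(* Partially ordered vector spaces. The positive cone is [set x | 0 <= x]; it
   is proper because <= is antisymmetric, and need not be generating. *)
HB.mixin Record isPOVect (R : realType) (E : Type)
    of Num.POrderedZmodule E & GRing.Lmodule R E := {
  lev_add2r : forall z x y : E, x <= y -> x + z <= y + z ;
  scalev_ge0 : forall (a : R) (x : E), 0 <= a -> 0 <= x -> 0 <= a *: x
}.

#[short(type="povectType")]
HB.structure Definition POVect (R : realType) :=
  {E of isPOVect R E & Num.POrderedZmodule E & GRing.Lmodule R E}.

HB.mixin Record isSigmaMonotoneComplete (R : realType) (E : Type)
    of POVect R E := {
  sigma_monotone_complete : forall x : nat -> E,
    {homo x : m n / (m <= n)%N >-> m <= n} -> has_ubound (range x) ->
    supremums (range x) !=set0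
}.

#[short(type="smcVectType")]
HB.structure Definition SMCVect (R : realType) :=
  {E of isSigmaMonotoneComplete R E & POVect R E}.

Definition directed (I : Type) (leI : I -> I -> Prop) : Prop :=
  [/\ inhabited I, forall i, leI i i,
      forall i j k, leI i j -> leI j k -> leI i k
    & forall i j, exists k, leI i k /\ leI j k].

Section OrderProperties.
Context (R : realType) (E : povectType R).

Definition net_up (I : Type) (leI : I -> I -> Prop) (x : I -> E) (s : E) :=
  (forall i j, leI i j -> x i <= x j) /\ supremums (range x) s.

Definition net_down (I : Type) (leI : I -> I -> Prop) (x : I -> E) (s : E) :=
  (forall i j, leI i j -> x j <= x i) /\ infimums (range x) s.

Definition seq_down (x : nat -> E) (s : E) :=
  net_down (fun m n => (m <= n)%N) x s.

Definition monotone_complete : Prop :=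
  forall (I : Type) (leI : I -> I -> Prop) (x : I -> E), directed leI ->
    (forall i j, leI i j -> x i <= x j) -> has_ubound (range x) ->
    supremums (range x) !=set0.

Definition sigma_dedekind_complete : Prop :=
  forall A : set E, A !=set0 -> countable A -> has_ubound A ->
    supremums A !=set0.

Definition dedekind_complete : Prop :=
  forall A : set E, A !=set0 -> has_ubound A -> supremums A !=set0.

Definition countable_sup_property : Prop :=
  forall (I : Type) (leI : I -> I -> Prop) (x : I -> E) (s : E), directed leI ->
    (forall i, 0 <= x i) -> 0 <= s -> net_up leI x s ->
    exists l : nat -> I, supremums (range (x \o l)) s.

Definition vector_lattice : Prop :=
  forall x y : E,
    supremums [set x; y] !=set0 /\ infimums [set x; y] !=set0.

End OrderProperties.

Arguments monotone_complete {R} E.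
Arguments sigma_dedekind_complete {R} E.
Arguments dedekind_complete {R} E.
Arguments countable_sup_property {R} E.
Arguments vector_lattice {R} E.

Section OperatorProperties.
Context (R : realType) (E F : povectType R).
Implicit Type T : E -> F.

Definition positive_operator T : Prop :=
  linear T /\ forall x, 0 <= x -> 0 <= T x.

Definition order_continuous T : Prop :=
  positive_operator T /\
  forall (I : Type) (leI : I -> I -> Prop) (x : I -> E), directed leI ->
    net_down leI x 0 -> net_down leI (T \o x) 0.

Definition sigma_order_continuous T : Prop :=
  positive_operator T /\
  forall x : nat -> E, seq_down x 0 -> seq_down (T \o x) 0.

Definition strictly_positive T : Prop :=
  positive_operator T /\ forall x, 0 <= x -> T x = 0 -> x = 0.

Definition vector_lattice_hom T : Prop :=
  [/\ vector_lattice E, vector_lattice F, linear T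
    , forall x y s, supremums [set x; y] s -> supremums [set T x; T y] (T s)
    & forall x y s, infimums [set x; y] s -> infimums [set T x; T y] (T s)].

End OperatorProperties.

(* The extended space E `|` {oo}, with the single point at infinity on top. *)
Inductive extspace (E : Type) : Type := Fin of E | Infty.
Arguments Fin {E} _.
Arguments Infty {E}.

Section ExtendedChoice.
Context (E : choiceType).

Let option_of (x : extspace E) := if x is Fin a then Some a else None.
Let of_option x : extspace E := if x is Some a then Fin a else Infty.
Let option_ofK : cancel option_of of_option. Proof. by case. Qed.

HB.instance Definition _ := Choice.copy (extspace E) (can_type option_ofK).

End ExtendedChoice.

Section Extended.
Context (R : realType) (E : povectType R).
Implicit Types x y z : extspace E.

Definition ext_le x y : bool :=
  match x, y with
  | _, Infty => true
  | Infty, Fin _ => false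
  | Fin a, Fin b => a <= b
  end.

Let ext_le_refl : reflexive ext_le.
Proof. by case=> //= a; exact: lexx. Qed.

Let ext_le_anti : antisymmetric ext_le.
Proof. by case=> [a|] [b|] //= /le_anti ->. Qed.

Let ext_le_trans : transitive ext_le.
Proof. by case=> [a|] [b|] [c|] //=; exact: le_trans. Qed.

HB.instance Definition _ := Order.Le_isPOrder.Build ring_display (extspace E)
  ext_le_refl ext_le_anti ext_le_trans.

Definition ext_add x y : extspace E :=
  match x, y with
  | Fin a, Fin b => Fin (a + b)
  | _, _ => Infty
  end.

Let ext_addA : associative ext_add.
Proof. by case=> [a|] [b|] [c|] //=; rewrite addrA. Qed.

Let ext_addC : commutative ext_add.
Proof. by case=> [a|] [b|] //=; rewrite addrC. Qed.

Let ext_add0 : left_id (Fin 0) ext_add.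
Proof. by case=> [a|] //=; rewrite add0r. Qed.

HB.instance Definition _ := GRing.isNmodule.Build (extspace E)
  ext_addA ext_addC ext_add0.

(* r * oo is only meaningful for r >= 0. *)
Definition ext_scale (r : R) x : extspace E :=
  match x with
  | Fin a => Fin (r *: a)
  | Infty => if r == 0 then 0 else Infty
  end.

(* The finite part, with the junk value 0 at infinity. *)
Definition ext_fin x : E := if x is Fin a then a else 0.

End Extended.

Record omeasure d (X : measurableType d) (R : realType) (E : povectType R) :=
  OMeasure {
    omeas :> set X -> extspace E ;
    omeas0 : omeas set0 = 0 ;
    omeas_ge0 : forall A, measurable A -> Fin 0 <= omeas A ;
    omeas_sigma_additive : forall A : nat -> set X,
      (forall n, measurable (A n)) -> trivIset setT A ->
      supremums (range (fun N => \sum_(n < N.+1) omeas (A n)))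
                (omeas (\bigcup_n A n))
  }.

Section OrderIntegral.
Context d (X : measurableType d) (R : realType) (E : povectType R).
Variable mu : omeasure X E.

Definition almost_everywhere (P : X -> Prop) : Prop :=
  exists A, [/\ measurable A, mu A = 0 & forall x, ~ P x -> A x].

(* The elementary functions are the elements of {nnsfun X >-> R}. Their integral
   is computed from the representation in which the sets are the fibres. *)
Definition elementary_integral (phi : {nnsfun X >-> R}) : extspace E :=
  \sum_(r \in range phi) ext_scale r (mu (phi @^-1` [set r])).

Definition is_ointegral (f : X -> \bar R) (v : extspace E) : Prop :=
  exists phi : nat -> {nnsfun X >-> R},
    [/\ forall x, {homo (fun n => phi n x) : m n / (m <= n)%N >-> m <= n},
        forall x, (phi n x)%:E @[n --> \oo] --> f x
      & supremums (range (fun n => elementary_integral (phi n))) v].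

Definition ointegral (f : X -> \bar R) : extspace E :=
  xget Infty (is_ointegral f).

Definition calL1_pred (f : X -> R) : bool :=
  `[< measurable_fun setT f /\ ointegral (fun x => `|f x|%:E) <> Infty >].

Definition null_pred (f : X -> R) : bool :=
  `[< measurable_fun setT f /\ almost_everywhere (fun x => f x = 0) >].

End OrderIntegral.

Section POVectTheory.
Context (R : realType) (E : povectType R).
Implicit Types x y z : E.

Lemma lev_add2l z x y : x <= y -> z + x <= z + y.
Proof. by rewrite ![z + _]addrC; exact: lev_add2r. Qed.

Lemma lev_add x y z t : x <= y -> z <= t -> x + z <= y + t.
Proof. by move=> xy zt; apply: le_trans (lev_add2l y zt); exact: lev_add2r. Qed.

Lemma lev_subr_addr x y z : (x <= y - z) = (x + z <= y).
Proof.
apply/idP/idP => [/(lev_add2r z)|/(lev_add2r (- z))]; first by rewrite subrK.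
by rewrite addrK.
Qed.

Lemma subv_ge0 x y : (0 <= y - x) = (x <= y).
Proof. by rewrite lev_subr_addr add0r. Qed.

Lemma scalev_le (a : R) x y : 0 <= a -> x <= y -> a *: x <= a *: y.
Proof. by move=> a0 xy; rewrite -subv_ge0 -scalerBr scalev_ge0// subv_ge0. Qed.

End POVectTheory.

Section SMCVectTheory.
Context (R : realType) (E : smcVectType R).

Lemma smc_archimedean (y e : E) :
  (forall n : nat, y *+ n <= e) -> y <= 0.
Proof.
move=> ye; have e0 : 0 <= e := ye 0%N.
pose u n : E := - (n.+1%:R^-1 *: e).
have [||s [us su]] := @sigma_monotone_complete R E u.
- move=> m n mn; rewrite /u -[leRHS]add0r lev_subr_addr addrC -lev_subr_addr.
  rewrite sub0r opprK -subv_ge0 -scalerBl scalev_ge0// subr_ge0.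
  by rewrite lef_pV2 ?posrE// ler_nat.
- exists 0 => _ [n _ <-]; rewrite /u -[leLHS]add0r -[leRHS](addrN (n.+1%:R^-1 *: e)).
  by apply: lev_add2r; rewrite scalev_ge0.
have s0 : 0 <= s.
  suff /su h : ubound (range u) (s + s).
    by have := lev_add2r (- s) _ _ h; rewrite addrK subrr.
  move=> _ [n _ <-].
  have -> : u n = u (n.*2.+1) + u (n.*2.+1).
    rewrite /u -opprD -scalerDl; congr (- (_ *: _)).
    rewrite -doubleS -mul2n natrM invfM; set t := (n.+1%:R)^-1.
    by rewrite ![2^-1 * t]mulrC -splitr.
  by apply: lev_add; apply: us; exists (n.*2.+1).
suff : 0 <= - y by move=> /(lev_add2r y); rewrite add0r addNr.
apply: (le_trans s0); apply: su => _ [n _ <-].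
rewrite /u -[leRHS]add0r lev_subr_addr addrC -lev_subr_addr sub0r opprK.
rewrite -[y](scalerK (a := n.+1%:R))//.
  by apply: scalev_le => //; rewrite scaler_nat.
Qed.

End SMCVectTheory.

Section ExtendedTheory.
Context (R : realType) (E : povectType R).
Implicit Types x y z : extspace E.

Lemma ext_finE (a b : E) : (Fin a <= Fin b) = (a <= b).
Proof. by []. Qed.

Lemma ext_lexoo x : x <= Infty. Proof. by case: x. Qed.

Lemma ext_ooD x : Infty + x = Infty. Proof. by []. Qed.

Lemma ext_Doo x : x + Infty = Infty. Proof. by case: x. Qed.

Lemma ext_finD (a b : E) : Fin a + Fin b = Fin (a + b). Proof. by []. Qed.

Lemma ext_le_add x y z t : x <= y -> z <= t -> x + z <= y + t.
Proof.
case: y => [b|] ; last by move=> *; rewrite ext_ooD ext_lexoo.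
case: t => [c|]; last by move=> *; rewrite ext_Doo ext_lexoo.
case: x => [a|]//; case: z => [e|]//; rewrite !ext_finD !ext_finE; exact: lev_add.
Qed.

Lemma ext_le_addl x y : Fin 0 <= y -> x <= x + y.
Proof. by move=> y0; rewrite -[leLHS]addr0; exact: ext_le_add. Qed.

Lemma ext_add_ge0 x y : Fin 0 <= x -> Fin 0 <= y -> Fin 0 <= x + y.
Proof. by move=> x0 y0; apply: le_trans (ext_le_addl _ y0). Qed.

Lemma ext_sum_ge0 (I : Type) (s : seq I) (P : pred I) (f : I -> extspace E) :
  (forall i, P i -> Fin 0 <= f i) -> Fin 0 <= \sum_(i <- s | P i) f i.
Proof.
by move=> f0; elim/big_rec: _ => [|i x Pi x0]; rewrite ?lexx// ext_add_ge0// f0.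
Qed.

Lemma ext_scale0 x : ext_scale 0 x = 0.
Proof. by case: x => [a|]/=; rewrite ?scale0r// eqxx. Qed.

Lemma ext_scale1 x : ext_scale 1 x = x.
Proof. by case: x => [a|]/=; rewrite ?scale1r// oner_eq0. Qed.

Lemma ext_scaler0 (r : R) : ext_scale r (0 : extspace E) = 0.
Proof. by rewrite /= scaler0. Qed.

Lemma ext_scaleA (r s : R) x : ext_scale r (ext_scale s x) = ext_scale (r * s) x.
Proof.
case: x => [a|]/=; first by rewrite scalerA.
by rewrite mulf_eq0; case: (eqVneq s 0) => _; rewrite ?orbT ?orbF//= scaler0.
Qed.

Lemma ext_scaleDr (r : R) x y : ext_scale r (x + y) = ext_scale r x + ext_scale r y.
Proof.
have [->|r0] := eqVneq r 0; first by rewrite !ext_scale0 addr0.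
case: x => [a|]; last by rewrite ext_ooD /= (negbTE r0) ext_ooD.
case: y => [b|]; last by rewrite ext_Doo /= (negbTE r0) ext_Doo.
by rewrite ext_finD /= ext_finD scalerDr.
Qed.

Lemma ext_scale_sum (r : R) (I : Type) (s : seq I) (P : pred I)
    (f : I -> extspace E) :
  ext_scale r (\sum_(i <- s | P i) f i) = \sum_(i <- s | P i) ext_scale r (f i).
Proof.
exact: (big_morph (ext_scale r) (ext_scaleDr r) (ext_scaler0 r)).
Qed.

Lemma ext_scaleDl (r s : R) x : 0 <= r -> 0 <= s ->
  ext_scale (r + s) x = ext_scale r x + ext_scale s x.
Proof.
move=> r0 s0; case: x => [a|]; first by rewrite /= ext_finD scalerDl.
rewrite /= paddr_eq0//.
case: (eqVneq r 0) => _ /=; last by rewrite ext_ooD.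
by rewrite add0r.
Qed.

Lemma ext_scale_le (r : R) x y : 0 <= r -> x <= y -> ext_scale r x <= ext_scale r y.
Proof.
move=> r0; have [->|rn0] := eqVneq r 0; first by rewrite !ext_scale0.
case: y => [b|]; last by move=> _; rewrite /= (negbTE rn0) ext_lexoo.
by case: x => [a|]//= ab; exact: scalev_le.
Qed.

Lemma ext_scale_ge0 (r : R) x : 0 <= r -> Fin 0 <= x -> Fin 0 <= ext_scale r x.
Proof. by move=> r0 /(ext_scale_le r0); rewrite ext_scaler0. Qed.

Lemma ext_supD (a b : nat -> extspace E) A B :
  {homo a : m n / (m <= n)%N >-> m <= n} ->
  {homo b : m n / (m <= n)%N >-> m <= n} ->
  (forall n, Fin 0 <= a n) -> (forall n, Fin 0 <= b n) ->
  supremums (range a) A -> supremums (range b) B ->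
  supremums (range (fun n => a n + b n)) (A + B).
Proof.
move=> a_nd b_nd a0 b0 [aA Aa] [bB Bb]; split=> [_ [n _ <-]|[u|] ub].
- by apply: ext_le_add; [apply: aA | apply: bB]; exists n.
- have abu m n : a m + b n <= Fin u.
    apply: le_trans (ub _ (ex_intro2 _ _ (maxn m n) I erefl)).
    by apply: ext_le_add; [apply: a_nd | apply: b_nd]; rewrite ?leq_maxl ?leq_maxr.
  have [a' aE] : exists a', a = Fin \o a'.
    have h n : {c | a n = Fin c}.
      apply/cid; move: (abu n 0%N); case: (a n) => [c|]; first by exists c.
      by rewrite ext_ooD.
    by exists (fun n => sval (h n)); apply/funext => n /=; case: (h n).
  have [b' bE] : exists b', b = Fin \o b'.
    have h n : {c | b n = Fin c}.
      apply/cid; move: (abu 0%N n); case: (b n) => [c|]; first by exists c.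
      by rewrite ext_Doo.
    by exists (fun n => sval (h n)); apply/funext => n /=; case: (h n).
  have {}abu m n : a' m + b' n <= u by have := abu m n; rewrite aE bE.
  have Au n : A <= Fin (u - b' n).
    by apply: Aa => _ [m _ <-]; rewrite aE /= ext_finE lev_subr_addr.
  case: A Au {aA Aa} => [A|/(_ 0%N)//] Au.
  have /Bb : ubound (range b) (Fin (u - A)).
    move=> _ [n _ <-]; rewrite bE /= ext_finE lev_subr_addr addrC -lev_subr_addr.
    exact: (Au n).
  by case: B {bB Bb} => [B|//]; rewrite !ext_finE lev_subr_addr addrC.
- exact: ext_lexoo.
Qed.

Lemma ext_supZ (r : R) (a : nat -> extspace E) A : 0 <= r ->
  supremums (range a) A ->
  supremums (range (fun n => ext_scale r (a n))) (ext_scale r A).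
Proof.
move=> r0 [aA Aa]; have [->|rn0] := eqVneq r 0.
  split=> [_ [n _ <-]|u ub]; first by rewrite !ext_scale0.
  by have := ub _ (ex_intro2 _ _ 0%N I erefl); rewrite !ext_scale0.
split=> [_ [n _ <-]|u ub].
  by apply: ext_scale_le => //; apply: aA; exists n.
rewrite -[u]ext_scale1 -(mulfV rn0) -ext_scaleA; apply: ext_scale_le => //.
apply: Aa => _ [n _ <-].
rewrite -[a n]ext_scale1 -(mulVf rn0) -ext_scaleA.
by apply: ext_scale_le; rewrite ?invr_ge0//; apply: ub; exists n.
Qed.

Lemma ext_sup_sum (J : eqType) (s : seq J) (a : J -> nat -> extspace E) A :
  (forall i, i \in s -> {homo a i : m n / (m <= n)%N >-> m <= n}) ->
  (forall i n, i \in s -> Fin 0 <= a i n) ->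
  (forall i, i \in s -> supremums (range (a i)) (A i)) ->
  supremums (range (fun n => \sum_(i <- s) a i n)) (\sum_(i <- s) A i).
Proof.
elim: s => [|i s IHs] a_nd a0 aA.
  split=> [_ [n _ <-]|u ub]; first by rewrite !big_nil.
  by have := ub _ (ex_intro2 _ _ 0%N I erefl); rewrite !big_nil.
rewrite big_cons; under eq_fun do rewrite big_cons.
have sub j : j \in s -> j \in i :: s by rewrite inE orbC => ->.
apply: ext_supD.
- by apply: a_nd; rewrite inE eqxx.
- move=> m n mn; rewrite [leLHS]big_seq [leRHS]big_seq.
  elim/big_rec2: _ => // j x y js yx; apply: ext_le_add => //.
  exact: (a_nd j (sub j js)).
- by move=> n; apply: a0; rewrite inE eqxx.
- by move=> n; rewrite big_seq; apply: ext_sum_ge0 => j js; apply/a0/sub.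
- by apply: aA; rewrite inE eqxx.
- by apply: IHs => [j js|j n js|j js]; [apply/a_nd/sub|apply/a0/sub|apply/aA/sub].
Qed.

End ExtendedTheory.

Section MeasureTheory.
Context d (X : measurableType d) (R : realType) (E : povectType R).
Variable mu : omeasure X E.

Lemma omeasU (A B : set X) : measurable A -> measurable B -> A `&` B = set0 ->
  mu (A `|` B) = mu A + mu B.
Proof.
move=> mA mB AB0; have mAB n : measurable (bigcup2 A B n).
  by case: n => [|[|n]] //=.
have tAB : trivIset setT (bigcup2 A B) by rewrite -trivIset_bigcup2.
have := omeas_sigma_additive mu mAB tAB; rewrite bigcup2E => supAB.
apply: (is_subset1_supremums supAB); split.
  move=> _ [n _ <-]; case: n => [|n].
    by rewrite big_ord1 /= ext_le_addl// omeas_ge0.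
  rewrite 2!big_ord_recl/= big1 ?addr0// => i _.
  by rewrite /= omeas0.
move=> u /(_ (mu A + mu B)); apply; exists 1%N => //.
by rewrite !big_ord_recl big_ord0/= addr0.
Qed.

Lemma omeas_bigU (I : choiceType) (s : seq I) (F : I -> set X) :
  uniq s -> (forall i, measurable (F i)) -> trivIset [set` s] F ->
  mu (\big[setU/set0]_(i <- s) F i) = \sum_(i <- s) mu (F i).
Proof.
elim: s => [|i s IHs] /=; first by rewrite !big_nil omeas0.
move=> /andP[nis us] mF tF; rewrite !big_cons omeasU//.
- rewrite IHs//; apply: sub_trivIset tF => j /= js.
  by rewrite inE js orbT.
- by apply: bigsetU_measurable.
- rewrite -subset0 => x [Fix]; rewrite -bigcup_seq => -[j /= js Fjx].
  have ij : i = j.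
    apply: (tF i j); rewrite /= ?inE ?eqxx ?js ?orbT//.
    by exists x.
  by move: nis; rewrite ij js.
Qed.

Lemma le_omeas (A B : set X) : measurable A -> measurable B -> A `<=` B ->
  mu A <= mu B.
Proof.
move=> mA mB AB; rewrite -(setDUK AB) omeasU//.
- by apply/ext_le_addl/omeas_ge0/measurableD.
- exact: measurableD.
- by rewrite setDIK.
Qed.

Lemma omeas_bigcup (F : nat -> set X) : (forall n, measurable (F n)) ->
  (forall m n, (m <= n)%N -> F m `<=` F n) ->
  supremums (range (fun n => mu (F n))) (mu (\bigcup_n F n)).
Proof.
move=> mF ndF; have mD := seqDU_measurable mF.
have := omeas_sigma_additive mu mD (trivIset_seqDU F).
rewrite -seqDU_bigcup_eq.
suff -> : (fun N => mu (F N)) = (fun N => \sum_(n < N.+1) mu (seqDU F n)) by [].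
apply/funext => N.
rewrite -(big_mkord xpredT (fun n => mu (seqDU F n))) -omeas_bigU//.
- rewrite big_mkord -bigsetU_seqDU; congr (mu _); apply/seteqP; split => x.
    by move=> FNx; rewrite -bigcup_mkord; exists N => /=.
  by rewrite -bigcup_mkord => -[n /=]; rewrite ltnS => nN; exact: ndF.
- by rewrite iota_uniq.
- by apply: sub_trivIset (trivIset_seqDU F).
Qed.

Lemma elementary_integralE (I : choiceType) (s : seq I) (r : I -> R)
    (A : I -> set X) (phi : {nnsfun X >-> R}) :
  uniq s -> (forall i, measurable (A i)) -> trivIset [set` s] A ->
  (forall i x, i \in s -> A i x -> phi x = r i) ->
  (forall x, (forall i, i \in s -> ~ A i x) -> phi x = 0) ->
  elementary_integral mu phi = \sum_(i <- s) ext_scale (r i) (mu (A i)).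
Proof.
move=> us mA tA phiA phi0.
rewrite /elementary_integral fsbig_finite//=; set D := finmap.enum_fset _.
have inD c : (c \in D) = (c \in range phi).
  by rewrite -in_fset_set.
have fibre c : c != 0 ->
    mu (phi @^-1` [set c]) = \sum_(i <- s | r i == c) mu (A i).
  move=> c0; rewrite -big_filter -omeas_bigU ?filter_uniq//; last first.
    by apply: sub_trivIset tA => i /=; rewrite mem_filter => /andP[].
  congr (mu _); apply/seteqP; split => x.
    move=> /= phix; rewrite -bigcup_seq.
    apply: contrapT => nA; move/eqP: c0; apply.
    rewrite -phix; apply: phi0 => i si Aix; apply: nA; exists i => //=.
    by rewrite mem_filter si andbT -phix (phiA i x).
  rewrite -bigcup_seq => -[i /=]; rewrite mem_filter => /andP[/eqP <- si] Aix.
  exact: phiA.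
rewrite (eq_bigr (fun c => \sum_(i <- s | r i == c) ext_scale (r i) (mu (A i)))).
  rewrite (exchange_big_dep xpredT)//= [LHS]big_seq [RHS]big_seq.
  apply: eq_bigr => i si.
  have [Ai0|/set0P[x Aix]] := eqVneq (A i) set0.
    by rewrite Ai0 omeas0 ext_scaler0 big1.
  have rD : r i \in D.
    by rewrite inD inE; exists x => //; exact: phiA.
  rewrite (big_rem _ rD)/= eqxx big_seq_cond big1 ?addr0// => c.
  rewrite mem_rem_uniq ?finmap.fset_uniq// inE.
  by move=> /andP[/andP[/negP + _] /eqP rc]; rewrite rc eqxx.
move=> c _; have [->|c0] := eqVneq c 0.
  by rewrite ext_scale0 big1// => i /eqP ->; rewrite ext_scale0.
rewrite fibre// ext_scale_sum; apply: eq_bigr => i /eqP ->//.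
Qed.

Definition fibres (phi : {nnsfun X >-> R}) : seq R := finmap.enum_fset (fset_set (range phi)).

Lemma mem_fibres (phi : {nnsfun X >-> R}) x : phi x \in fibres phi.
Proof. by rewrite in_fset_set// inE; exists x. Qed.

Lemma uniq_fibres (phi : {nnsfun X >-> R}) : uniq (fibres phi).
Proof. exact: finmap.fset_uniq. Qed.
#[local] Hint Resolve uniq_fibres : core.

Lemma elementary_integral_fibres (phi : {nnsfun X >-> R}) :
  elementary_integral mu phi =
  \sum_(c <- fibres phi) ext_scale c (mu (phi @^-1` [set c])).
Proof. by rewrite /elementary_integral fsbig_finite. Qed.

Lemma fibres_ge0 (phi : {nnsfun X >-> R}) c : c \in fibres phi -> 0 <= c.
Proof. by rewrite in_fset_set// inE => -[x _ <-]. Qed.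

Lemma elementary_integral_ge0 (phi : {nnsfun X >-> R}) :
  Fin 0 <= elementary_integral mu phi.
Proof.
rewrite elementary_integral_fibres big_seq; apply: ext_sum_ge0 => c cphi.
by rewrite ext_scale_ge0 ?omeas_ge0//; exact: fibres_ge0 cphi.
Qed.

Lemma elementary_integralD (phi psi chi : {nnsfun X >-> R}) :
  (forall x, chi x = phi x + psi x) ->
  elementary_integral mu chi = elementary_integral mu phi + elementary_integral mu psi.
Proof.
move=> chiE.
pose s := [seq (a, b) | a <- fibres phi, b <- fibres psi].
pose A (p : R * R) := phi @^-1` [set p.1] `&` psi @^-1` [set p.2].
have us : uniq s by apply: allpairs_uniq => // -[a b] [a' b'].
have mA p : measurable (A p) by apply: measurableI.
have tA : trivIset [set` s] A.
  by move=> [a b] [a' b'] _ _ /= [x [[/= <- <-] [/= <- <-]]].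
have sA x : (forall p, p \in s -> ~ A p x) -> False.
  by move=> /(_ (phi x, psi x)); apply; [apply: allpairs_f; exact: mem_fibres | split].
rewrite (@elementary_integralE _ s (fun p => p.1 + p.2) A)//; first last.
- by move=> x /sA.
- by move=> [a b] x _ [/= <- <-].
rewrite (@elementary_integralE _ s fst A phi)//; first last.
- by move=> x /sA.
- by move=> [a b] x _ [/= <- _].
rewrite (@elementary_integralE _ s snd A psi)//; first last.
- by move=> x /sA.
- by move=> [a b] x _ [/= _ <-].
rewrite -big_split big_seq [RHS]big_seq; apply: eq_bigr => -[a b].
case/allpairsP => -[a' b'] /= [aphi bpsi [-> ->]].
by rewrite ext_scaleDl//; [exact: fibres_ge0 aphi | exact: fibres_ge0 bpsi].
Qed.

Lemma elementary_integralZ (k : R) (phi chi : {nnsfun X >-> R}) :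
  (forall x, chi x = k * phi x) ->
  elementary_integral mu chi = ext_scale k (elementary_integral mu phi).
Proof.
move=> chiE; rewrite (elementary_integral_fibres phi) ext_scale_sum.
rewrite (@elementary_integralE _ (fibres phi) (fun c => k * c)
  (fun c => phi @^-1` [set c]))//.
- by apply: eq_bigr => c _; rewrite ext_scaleA.
- exact: trivIset_preimage1.
- by move=> c x _ /= <-.
- by move=> x /(_ _ (mem_fibres phi x)) /(_ erefl).
Qed.

Lemma le_elementary_integral (phi psi : {nnsfun X >-> R}) :
  (forall x, phi x <= psi x) ->
  elementary_integral mu phi <= elementary_integral mu psi.
Proof.
move=> le_phi_psi.
pose s := [seq (a, b) | a <- fibres phi, b <- fibres psi].
pose A (p : R * R) := phi @^-1` [set p.1] `&` psi @^-1` [set p.2].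
have us : uniq s by apply: allpairs_uniq => // -[a b] [a' b'].
have mA p : measurable (A p) by apply: measurableI.
have tA : trivIset [set` s] A.
  by move=> [a b] [a' b'] _ _ /= [x [[/= <- <-] [/= <- <-]]].
have sA x : (forall p, p \in s -> ~ A p x) -> False.
  by move=> /(_ (phi x, psi x)); apply; [apply: allpairs_f; exact: mem_fibres | split].
rewrite (@elementary_integralE _ s fst A phi)//; first last.
- by move=> x /sA.
- by move=> [a b] x _ [/= <- _].
rewrite (@elementary_integralE _ s snd A psi)//; first last.
- by move=> x /sA.
- by move=> [a b] x _ [/= _ <-].
rewrite big_seq [leRHS]big_seq.
elim/big_rec2: _ => // -[a b] x y sab xy; apply: ext_le_add => //=.
have [->|/set0P[z [/= az bz]]] := eqVneq (A (a, b)) set0.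
  by rewrite omeas0 !ext_scaler0.
have [a0 ab] : 0 <= a /\ 0 <= b - a.
  by rewrite -az -bz subr_ge0.
have {2}-> : b = a + (b - a) by rewrite addrC subrK.
rewrite ext_scaleDl//.
by rewrite ext_le_addl// ext_scale_ge0// omeas_ge0.
Qed.

End MeasureTheory.

Section OrderIntegralTheory.
Context d (X : measurableType d) (R : realType) (E : smcVectType R).
Variable mu : omeasure X E.
Implicit Types (f g : X -> \bar R) (v w : extspace E).

Lemma le_elementary_integral_sup (psi : {nnsfun X >-> R})
    (phi : nat -> {nnsfun X >-> R}) v :
  (forall x, {homo (fun n => phi n x) : m n / (m <= n)%N >-> m <= n}) ->
  (forall x c, c < psi x -> exists n, c < phi n x) ->
  ubound (range (fun n => elementary_integral mu (phi n))) v ->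
  elementary_integral mu psi <= v.
Proof.
case: v => [w|] phi_nd psi_phi ubw; last exact: ext_lexoo.
have scaled c : 0 < c < 1 -> ext_scale c (elementary_integral mu psi) <= Fin w.
  move=> /andP[c0 c1].
  pose A n := [set x | c * psi x <= phi n x].
  have mA n : measurable (A n).
    by rewrite -[A n]setTI; apply: measurable_fun_le => //; exact: measurable_realfun.measurable_funM.
  have AT : \bigcup_n A n = setT.
    rewrite -subTset => x _; have [px0|] := eqVneq (psi x) 0.
      by exists 0%N => //=; rewrite /A /= px0 mulr0.
    rewrite neq_lt ltNge fun_ge0/= => px0.
    have [n /ltW cn] : exists n, c * psi x < phi n x.
      by apply: psi_phi; rewrite gtr_pMl.
    by exists n.
  have psiAE n : elementary_integral mu (proj_nnsfun psi (mA n)) =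
      \sum_(r <- fibres psi) ext_scale r (mu (psi @^-1` [set r] `&` A n)).
    apply: elementary_integralE => //.
    - exact: uniq_fibres.
    - by move=> i; apply: measurableI.
    - by move=> i j _ _ [x [[/= <- _] [/= <- _]]].
    - by move=> r x _ [/= <- Anx]; rewrite measurable_realfun.mindicE mem_set// mulr1.
    - move=> x /(_ (psi x) (mem_fibres psi x)) /= nA; rewrite measurable_realfun.mindicE memNset ?mulr0//.
      by move=> Anx; exact: nA.
  have : supremums (range (fun n => elementary_integral mu (proj_nnsfun psi (mA n))))
      (elementary_integral mu psi).
    rewrite elementary_integral_fibres.
    under [X in range X]eq_fun do rewrite psiAE.
    have Amono m n : (m <= n)%N -> A m `<=` A n.
      by move=> mn x /le_trans; apply; exact: phi_nd.
    have mpA r n : measurable (psi @^-1` [set r] `&` A n) by apply: measurableI.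
    apply: ext_sup_sum.
    - move=> r /fibres_ge0 r0 m n mn; apply: ext_scale_le => //.
      apply: (le_omeas mu (mpA r m) (mpA r n)). by move=> x [rx /(Amono _ _ mn) Ax]; split.
    - move=> r n /fibres_ge0 r0; apply: ext_scale_ge0 => //; exact: omeas_ge0.
    - move=> r /fibres_ge0 r0; apply: ext_supZ => //.
      rewrite -[X in mu X]setIT -AT setI_bigcupr; apply: omeas_bigcup => // m n mn.
      by move=> x [rx /(Amono _ _ mn) Ax]; split.
  move=> /(ext_supZ (ltW c0)) [_]; apply => _ [n _ <-].
  apply: le_trans (ubw _ (ex_intro2 _ _ n I erefl)).
  rewrite -(elementary_integralZ mu (chi := scale_nnsfun (proj_nnsfun psi (mA n)) (ltW c0)))//.
  apply: le_elementary_integral => x /=; rewrite measurable_realfun.mindicE.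
  have [/set_mem Anx|_] := boolP (x \in A n); first by rewrite mulr1.
  by rewrite !mulr0 fun_ge0.
have half01 : 0 < (2^-1 : R) < 1 by rewrite invr_gt0 ltr0n invf_lt1// ltr1n.
have := elementary_integral_ge0 mu psi; move: scaled.
case: (elementary_integral mu psi) => [e|]; last first.
  by move=> /(_ _ half01) /=; rewrite invr_eq0 pnatr_eq0.
rewrite !ext_finE => scaled e0.
have : e - w <= 0.
  apply: (@smc_archimedean _ _ _ e) => n.
  have cn : 0 < (1 - n.+2%:R^-1 : R) < 1.
    by rewrite subr_gt0 invf_lt1// ltr1n/= gtrBl invr_gt0.
  have /= := scaled _ cn; rewrite ext_finE => ce.
  have -> : (e - w) *+ n = n%:R *: (e - w) by rewrite scaler_nat.
  apply: (@le_trans _ _ (n%:R *: (n.+2%:R^-1 *: e))).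
    apply: scalev_le => //; rewrite -subv_ge0 opprB addrCA -opprB subv_ge0.
    by rewrite scalerBl scale1r in ce.
  rewrite scalerA -subv_ge0 -[X in X - _]scale1r -scalerBl scalev_ge0//.
  by rewrite subr_ge0 ler_pdivrMr// mul1r ler_nat ltnW.
by move=> /(lev_add2r w); rewrite subrK add0r.
Qed.

Lemma is_ointegral_le f g v w : (forall x, (f x <= g x)%E) ->
  is_ointegral mu f v -> is_ointegral mu g w -> v <= w.
Proof.
move=> fg [phi [phi_nd phi_f [_ supv]]] [psi [psi_nd psi_g [supw _]]].
apply: supv => _ [n _ <-].
apply: (le_elementary_integral_sup psi_nd) => // x c cphi.
apply: contrapT => /forallNP psic.
have : (g x <= c%:E)%E.
  apply: (cvge_le _ (psi_g x)); apply: nearW => m.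
  by rewrite lee_fin leNgt; apply/negP.
move=> /(le_trans (fg x)); apply/negP; rewrite -ltNge.
apply: (@lt_le_trans _ _ (phi n x)%:E); first by rewrite lte_fin.
apply: (cvge_ge _ (phi_f x)); exists n => // m /= nm.
by rewrite lee_fin; exact: phi_nd.
Qed.

Lemma is_ointegral_unique f : is_subset1 (is_ointegral mu f).
Proof.
by move=> v w fv fw; apply/le_anti; rewrite !(is_ointegral_le _ fv fw, is_ointegral_le _ fw fv).
Qed.

Lemma ointegralE f v : is_ointegral mu f v -> ointegral mu f = v.
Proof. by move=> fv; apply: xget_subset1 => //; exact: is_ointegral_unique. Qed.

Lemma ext_sup_exists (a : nat -> extspace E) :
  {homo a : m n / (m <= n)%N >-> m <= n} -> supremums (range a) !=set0.
Proof.
move=> a_nd; have [[w aw]|nub] := pselect (exists w : E, ubound (range a) (Fin w)).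
  pose b n := ext_fin (a n).
  have bE n : a n = Fin (b n).
    by move: (aw _ (ex_intro2 _ _ n I erefl)); rewrite /b; case: (a n).
  have [||s [bs sb]] := @sigma_monotone_complete _ _ b.
  - by move=> m n mn; rewrite -ext_finE -!bE; exact: a_nd.
  - by exists w => _ [n _ <-]; rewrite -ext_finE -bE; apply: aw; exists n.
  exists (Fin s); split => [_ [n _ <-]|[u|] au]; last exact: ext_lexoo.
    by rewrite bE ext_finE; apply: bs; exists n.
  rewrite ext_finE; apply: sb => _ [n _ <-].
  by rewrite -ext_finE -bE; apply: au; exists n.
exists Infty; split => [_ [n _ <-]|[u|] au]; first exact: ext_lexoo.
  by case: nub; exists u.
exact: ext_lexoo.
Qed.

Lemma is_ointegral_exists f : measurable_fun setT f -> (forall x, (0 <= f x)%E) ->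
  is_ointegral mu f (ointegral mu f).
Proof.
move=> mf f0; apply: (xgetPex Infty).
have [phi [phi_nd phif]] := approximation measurableT mf (fun x _ => f0 x).
have {}phi_nd x : {homo (fun n => phi n x) : m n / (m <= n)%N >-> m <= n}.
  by move=> m n /phi_nd /lefP.
have [|v] := @ext_sup_exists (fun n => elementary_integral mu (phi n)).
  by move=> m n mn; apply: le_elementary_integral => x; exact: phi_nd.
by exists v, phi; split => // x; exact: phif.
Qed.

Lemma is_ointegralD f g v w : (forall x, (0 <= f x)%E) -> (forall x, (0 <= g x)%E) ->
  is_ointegral mu f v -> is_ointegral mu g w ->
  is_ointegral mu (fun x => f x + g x)%E (v + w).
Proof.
move=> f0 g0 [phi [phi_nd phi_f supv]] [psi [psi_nd psi_g supw]].
exists (fun n => add_nnsfun (phi n) (psi n)); split=> [x m n mn /=|x|].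
- by apply: lerD; [exact: phi_nd | exact: psi_nd].
- have fgx : (f x +? g x)%E by apply: ge0_adde_def; rewrite inE.
  exact: (cvgeD fgx (phi_f x) (psi_g x)).
- have -> : (fun n => elementary_integral mu (add_nnsfun (phi n) (psi n))) =
      fun n => elementary_integral mu (phi n) + elementary_integral mu (psi n).
    by apply/funext => n; exact: elementary_integralD.
  apply: ext_supD => // [m n mn|m n mn|n|n]; try exact: elementary_integral_ge0.
    by apply: le_elementary_integral => x; exact: phi_nd.
  by apply: le_elementary_integral => x; exact: psi_nd.
Qed.

Lemma is_ointegralZ (k : R) f v : 0 <= k ->
  is_ointegral mu f v -> is_ointegral mu (fun x => k%:E * f x)%E (ext_scale k v).
Proof.
move=> k0 [phi [phi_nd phi_f supv]].
exists (fun n => scale_nnsfun (phi n) k0); split=> [x m n mn /=|x|].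
- by apply: ler_wpM2l => //; exact: phi_nd.
- exact: (cvgeZl (y := k%:E) _ (phi_f x)).
- have -> : (fun n => elementary_integral mu (scale_nnsfun (phi n) k0)) =
      fun n => ext_scale k (elementary_integral mu (phi n)).
    by apply/funext => n; exact: elementary_integralZ.
  exact: ext_supZ.
Qed.

Lemma is_ointegral_nnsfun (phi : {nnsfun X >-> R}) :
  is_ointegral mu (fun x => (phi x)%:E) (elementary_integral mu phi).
Proof.
exists (fun=> phi); split=> [x m n _ //|x|]; first exact: cvg_cst.
split=> [_ [_ _ <-]//|u]; apply; by exists 0%N.
Qed.

Lemma almost_everywhere_subset (P Q : X -> Prop) : (forall x, P x -> Q x) ->
  almost_everywhere mu P -> almost_everywhere mu Q.
Proof.
move=> PQ [A [mA A0 PA]]; exists A; split => // x nQ; apply: PA.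
by move=> /PQ.
Qed.

Lemma almost_everywhereI (P Q : X -> Prop) :
  almost_everywhere mu P -> almost_everywhere mu Q ->
  almost_everywhere mu (fun x => P x /\ Q x).
Proof.
move=> [A [mA A0 PA]] [B [mB B0 QB]]; exists (A `|` B); split.
- exact: measurableU.
- rewrite -(setDUK (@subsetUl _ A B)) omeasU//.
  + apply/le_anti; rewrite A0 add0r; apply/andP; split; last first.
      by apply/omeas_ge0/measurableD => //; exact: measurableU.
    rewrite -B0; apply: le_omeas => //.
      by apply: measurableD => //; exact: measurableU.
    by move=> x [[]].
  + by apply: measurableD => //; exact: measurableU.
  + by rewrite setDIK.
- by move=> x /not_andP[/PA|/QB]; [left | right].
Qed.

Lemma almost_everywhereT (P : X -> Prop) : (forall x, P x) -> almost_everywhere mu P.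
Proof. by move=> PT; exists set0; split => //; exact: omeas0. Qed.

(* Independence of the order integral of the choices made in its definition. *)
Lemma ointegral_sup f (phi : nat -> {nnsfun X >-> R}) :
  (forall x, {homo (fun n => phi n x) : m n / (m <= n)%N >-> m <= n}) ->
  (forall x, (phi n x)%:E @[n --> \oo] --> f x) ->
  supremums (range (fun n => elementary_integral mu (phi n))) (ointegral mu f).
Proof.
move=> phi_nd phi_f.
have [|v vsup] := @ext_sup_exists (fun n => elementary_integral mu (phi n)).
  by move=> m n mn; apply: le_elementary_integral => x; exact: phi_nd.
by rewrite (@ointegralE f v)//; exists phi.
Qed.

Lemma le_ointegral f g : measurable_fun setT f -> measurable_fun setT g ->
  (forall x, (0 <= f x)%E) -> (forall x, (f x <= g x)%E) ->
  ointegral mu f <= ointegral mu g.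
Proof.
move=> mf mg f0 fg; apply: (is_ointegral_le fg); apply: is_ointegral_exists => // x.
exact: le_trans (fg x).
Qed.

Lemma measurable_abs (h : X -> R) : measurable_fun setT h ->
  measurable_fun setT (fun x => (`|h x|)%:E).
Proof.
move=> mh; rewrite -[fun x => _]/(EFin \o (fun x => `|h x|)).
by apply/measurable_EFinP; exact: measurableT_comp.
Qed.

Lemma calL1_submod : submod_closed (calL1_pred mu).
Proof.
split=> [|k f g /asboolP[mf If] /asboolP[mg Ig]]; apply/asboolP; split => //.
- exact: measurable_cst.
- rewrite (@ointegralE _ (elementary_integral mu nnsfun0)); last first.
    rewrite (_ : (fun x => _) = fun x => ((nnsfun0 : {nnsfun X >-> R}) x)%:E).
      exact: is_ointegral_nnsfun.
    by apply/funext => x; rewrite normr0.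
  rewrite (@elementary_integralZ _ _ _ _ mu 0 nnsfun0) ?ext_scale0//.
  by move=> x; rewrite mul0r.
- apply: measurable_funD => //; exact: measurable_realfun.measurable_funM.
- have abs0 (h : X -> R) x : (0 <= (`|h x|)%:E)%E by rewrite lee_fin.
  have Sf := is_ointegral_exists (measurable_abs mf) (abs0 f).
  have Sg := is_ointegral_exists (measurable_abs mg) (abs0 g).
  have Skf := is_ointegralZ (normr_ge0 k) Sf.
  have S := is_ointegralD _ (abs0 g) Skf Sg.
  have mh : measurable_fun setT (k *: f + g : X -> R).
    by apply: measurable_funD => //; exact: measurable_realfun.measurable_funM.
  have {}S := S (fun x => mule_ge0 (normr_ge0 k : (0 <= (`|k|)%:E)%E) (abs0 f x)).
  have := is_ointegral_le _ (is_ointegral_exists (measurable_abs mh) (abs0 _)) S.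
  move: If Ig S; case: (ointegral mu _) => // a _; case: (ointegral mu _) => // b _.
  move=> _ h.
  move=> Ioo; move: h; rewrite Ioo => h; suff: false by [].
  apply: h => x.
  by rewrite -EFinM -EFinD lee_fin -normrM ler_normD.
Qed.

Lemma null_submod : submod_closed (null_pred mu).
Proof.
split=> [|k f g /asboolP[mf If] /asboolP[mg Ig]]; apply/asboolP; split => //.
- exact: measurable_cst.
- exact: almost_everywhereT.
- apply: measurable_funD => //; exact: measurable_realfun.measurable_funM.
- apply: almost_everywhere_subset (almost_everywhereI If Ig) => x [fx gx].
  by rewrite -[LHS]/(k * f x + g x) fx gx mulr0 addr0.
Qed.

Lemma null_ideal (f g : X -> R) : measurable_fun setT f ->
  (forall x, `|f x| <= `|g x|) -> null_pred mu g -> null_pred mu f.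
Proof.
move=> mf fg /asboolP[mg g0]; apply/asboolP; split => //.
apply: almost_everywhere_subset g0 => x gx0; apply/eqP.
by rewrite -normr_le0 (le_trans (fg x))// gx0 normr0.
Qed.

Lemma null_calL1 (f : X -> R) : null_pred mu f -> calL1_pred mu f.
Proof.
move=> /asboolP[mf [A [mA A0 fA]]]; apply/asboolP; split => //.
suff -> : ointegral mu (fun x => (`|f x|)%:E) = 0 by [].
apply: ointegralE.
have mabs := measurable_abs mf.
have abs0 x : (0 <= (`|f x|)%:E)%E by rewrite lee_fin.
have [phi [phi_nd phif]] := approximation measurableT mabs (fun x _ => abs0 x).
have {}phi_nd x : {homo (fun n => phi n x) : m n / (m <= n)%N >-> m <= n}.
  by move=> m n /phi_nd /lefP.
exists phi; split => // [x|]; first exact: phif.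
have phi0 n : elementary_integral mu (phi n) = 0.
  rewrite elementary_integral_fibres big1_seq// => c /andP[_ cphi].
  have [->|c0] := eqVneq c 0; first by rewrite ext_scale0.
  suff -> : mu (phi n @^-1` [set c]) = 0 by rewrite ext_scaler0.
  apply/le_anti; rewrite omeas_ge0// andbT -A0; apply: le_omeas => // x /= phic.
  apply: fA => fx0; have : ((phi n x)%:E <= (`|f x|)%:E)%E.
    apply: (cvge_ge _ (phif x I)); exists n => // m /= nm.
    by rewrite lee_fin; exact: phi_nd.
  rewrite fx0 normr0 lee_fin phic leNgt.
  by rewrite lt_neqAle eq_sym c0 (fibres_ge0 cphi).
split=> [_ [n _ <-]|u]; first by rewrite phi0.
by apply; exists 0%N.
Qed.

End OrderIntegralTheory.

Section CalL1.
Context d (X : measurableType d) (R : realType) (E : smcVectType R).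
Variable mu : omeasure X E.

HB.instance Definition _ := GRing.isSubmodClosed.Build R (X -> R)
  (calL1_pred mu) (calL1_submod mu).

Record calL1 := MkCalL1 {
  calL1_fun :> X -> R ;
  calL1_funP : calL1_fun \in calL1_pred mu
}.

HB.instance Definition _ := [isSub for calL1_fun].
HB.instance Definition _ := [Choice of calL1 by <:].
HB.instance Definition _ := [SubChoice_isSubLmodule of calL1 by <:].

Implicit Types f g h : calL1.

Definition calL1_le f g : bool := `[< forall x, f x <= g x >].

Let calL1_le_refl : reflexive calL1_le.
Proof. by move=> f; apply/asboolP => x. Qed.

Let calL1_le_anti : antisymmetric calL1_le.
Proof.
move=> f g /andP[/asboolP fg /asboolP gf]; apply/val_inj/funext => x.
by apply/le_anti; rewrite fg gf.
Qed.

Let calL1_le_trans : transitive calL1_le.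
Proof.
move=> f g h /asboolP gf /asboolP fh; apply/asboolP => x.
exact: le_trans (fh x).
Qed.

HB.instance Definition _ := Order.Le_isPOrder.Build ring_display calL1
  calL1_le_refl calL1_le_anti calL1_le_trans.

Lemma calL1_leP f g : reflect (forall x, f x <= g x) (f <= g).
Proof. exact: asboolP. Qed.

Let calL1_lev_add2r h f g : f <= g -> f + h <= g + h.
Proof. by move=> /calL1_leP fg; apply/calL1_leP => x; exact: lerD. Qed.

Let calL1_scalev_ge0 (a : R) f : 0 <= a -> 0 <= f -> 0 <= a *: f.
Proof. by move=> a0 /calL1_leP f0; apply/calL1_leP => x; exact: (mulr_ge0 a0 (f0 x)). Qed.

HB.instance Definition _ :=
  isPOVect.Build R calL1 calL1_lev_add2r calL1_scalev_ge0.

Lemma calL1_le_addl f g : 0 <= g -> f <= g + f.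
Proof. by move=> g0; have := lev_add2r f _ _ g0; rewrite add0r. Qed.

Definition calL1_null f : bool := null_pred mu f.

Let calL1_null_zmod : zmod_closed calL1_null.
Proof.
have [n0 nS] := null_submod mu; split => // f g nf ng.
have -> : (f - g : calL1) = - 1 *: g + f by rewrite scaleN1r addrC.
exact: nS.
Qed.

HB.instance Definition _ := GRing.isZmodClosed.Build calL1 calL1_null calL1_null_zmod.

Definition L1 : Type := 
  Quotient.quot (GRing.ZmodClosed.clone calL1 calL1_null _).

HB.instance Definition _ := Choice.on L1.
HB.instance Definition _ := EqQuotient.on L1.
HB.instance Definition _ := GRing.Zmodule.on L1.

Definition L1_class (f : calL1) : L1 := \pi_L1 f.

Lemma L1_classD f g : L1_class (f + g) = L1_class f + L1_class g.
Proof. exact: Quotient.pi_add. Qed.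

Lemma L1_class_eq f g : L1_class f = L1_class g <-> calL1_null (f - g).
Proof.
by split=> [/eqP|fg]; [|apply/eqP]; rewrite /L1_class -Quotient.idealrBE.
Qed.

Lemma L1_classK (u : L1) : L1_class (repr u) = u.
Proof. exact: reprK. Qed.

Definition L1_scale (a : R) (u : L1) : L1 := L1_class (a *: repr u).

Lemma L1_classZ a f : L1_class (a *: f) = L1_scale a (L1_class f).
Proof.
apply/L1_class_eq; rewrite -scalerBr /calL1_null.
have [n0 nS] := null_submod mu.
have /L1_class_eq nf : L1_class f = L1_class (repr (L1_class f)).
  by rewrite L1_classK.
by have := nS a _ _ nf n0; rewrite addr0.
Qed.

Let L1_scaleA a b u : L1_scale a (L1_scale b u) = L1_scale (a * b) u.
Proof. by rewrite -[u]L1_classK -!L1_classZ scalerA. Qed.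

Let L1_scale1 : left_id 1 L1_scale.
Proof. by move=> u; rewrite -[u]L1_classK -!L1_classZ scale1r. Qed.

Let L1_scaleDr : right_distributive L1_scale +%R.
Proof.
move=> a u v; rewrite -[u]L1_classK -[v]L1_classK.
by rewrite -L1_classD -!L1_classZ scalerDr L1_classD.
Qed.

Let L1_scaleDl u : {morph L1_scale^~ u : a b / a + b}.
Proof.
by move=> a b; rewrite -[u]L1_classK -!L1_classZ scalerDl L1_classD.
Qed.

HB.instance Definition _ := GRing.Zmodule_isLmodule.Build R L1
  L1_scaleA L1_scale1 L1_scaleDr L1_scaleDl.

Lemma L1_class_linear : linear L1_class.
Proof. by move=> a f g; rewrite L1_classD L1_classZ. Qed.

HB.instance Definition _ := GRing.isLinear.Build R calL1 L1 _ L1_class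
  L1_class_linear.

(* The positive cone of L1 is the image of the positive cone of calL1. *)
Definition L1_le (u v : L1) : bool :=
  `[< exists2 f, 0 <= f & L1_class f = v - u >].

Let L1_le_refl : reflexive L1_le.
Proof.
by move=> u; apply/asboolP; exists 0 => //; rewrite subrr linear0.
Qed.

Let L1_le_anti : antisymmetric L1_le.
Proof.
move=> u v /andP[/asboolP[f f0 fE] /asboolP[g g0 gE]].
suff nf : calL1_null f.
  have : L1_class f = 0.
    by rewrite -(linear0 L1_class); apply/L1_class_eq; rewrite subr0.
  by rewrite fE => /eqP; rewrite subr_eq0 eq_sym => /eqP.
have nfg : calL1_null (f + g).
  rewrite -[f + g]subr0; apply/L1_class_eq.
  by rewrite linearD linear0/= fE gE addrC subrKA subrr.
have /asboolP[mf _] := calL1_funP f.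
apply: (null_ideal mf) nfg => x.
move/calL1_leP: f0 => /(_ x) f0; move/calL1_leP: g0 => /(_ x) g0.
rewrite (ger0_norm f0); apply: le_trans (ler_norm _).
by rewrite lerDl.
Qed.

Let L1_le_trans : transitive L1_le.
Proof.
move=> v u w /asboolP[f f0 fE] /asboolP[g g0 gE]; apply/asboolP.
exists (g + f); first exact: (le_trans f0 (calL1_le_addl f g0)).
by rewrite linearD/= fE gE subrKA.
Qed.

HB.instance Definition _ := Order.Le_isPOrder.Build ring_display L1
  L1_le_refl L1_le_anti L1_le_trans.

Let L1_lev_add2r (w u v : L1) : u <= v -> u + w <= v + w.
Proof.
by move=> /asboolP[f f0 fE]; apply/asboolP; exists f; rewrite // fE opprD addrACA subrr addr0.
Qed.

Let L1_scalev_ge0 (a : R) (u : L1) : 0 <= a -> 0 <= u -> 0 <= a *: u.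
Proof.
move=> a0 /asboolP[f f0 fE]; apply/asboolP; exists (a *: f).
  exact: scalev_ge0.
by rewrite linearZ/= fE !subr0.
Qed.

HB.instance Definition _ := isPOVect.Build R L1 L1_lev_add2r L1_scalev_ge0.

End CalL1.

Section IntegralOfReal.
Context d (X : measurableType d) (R : realType) (E : smcVectType R).
Variable mu : omeasure X E.

Definition calL1_integral (f : calL1 mu) : E :=
  ext_fin (ointegral mu (fun x => (Num.max (f x) 0)%:E)) -
  ext_fin (ointegral mu (fun x => (Num.max (- f x) 0)%:E)).

Lemma ext_finK (v : extspace E) : v <> Infty -> Fin (ext_fin v) = v.
Proof. by case: v. Qed.

Lemma measurable_calL1 (f : calL1 mu) : measurable_fun setT f.
Proof. by have /asboolP[] := calL1_funP f. Qed.

(* Independence of the decomposition of f. *)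
Lemma calL1_integralE (f f1 f2 : calL1 mu) : 0 <= f1 -> 0 <= f2 -> f = f1 - f2 ->
  calL1_integral f = ext_fin (ointegral mu (fun x => (f1 x)%:E)) -
                     ext_fin (ointegral mu (fun x => (f2 x)%:E)).
Proof.
move=> /calL1_leP f1_0 /calL1_leP f2_0 fE.
pose p x := Num.max (f x) 0; pose n x := Num.max (- f x) 0.
have p0 x : (0 <= (p x)%:E)%E by rewrite lee_fin le_max lexx orbT.
have n0 x : (0 <= (n x)%:E)%E by rewrite lee_fin le_max lexx orbT.
have {}f1_0 x : (0 <= (f1 x)%:E)%E by rewrite lee_fin; exact: f1_0.
have {}f2_0 x : (0 <= (f2 x)%:E)%E by rewrite lee_fin; exact: f2_0.
have mf := measurable_calL1 f.
have mE (h : X -> R) : measurable_fun setT h -> measurable_fun setT (fun x => (h x)%:E).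
  by move=> mh; rewrite -[fun x => _]/(EFin \o h); exact/measurable_EFinP.
have mp : measurable_fun setT (fun x => (p x)%:E).
  by apply: mE; exact: measurable_maxr.
have mn : measurable_fun setT (fun x => (n x)%:E).
  by apply: mE; apply: measurable_maxr => //; exact: (measurable_calL1 (- f)).
have fin h (g : calL1 mu) : measurable_fun setT (fun x => (h x)%:E) ->
    (forall x, (0 <= (h x)%:E)%E) -> (forall x, h x <= `|g x|) ->
    exists a, ointegral mu (fun x => (h x)%:E) = Fin a.
  move=> mh h0 hg; have /asboolP[mg] := calL1_funP g.
  have := le_ointegral mu mh (measurable_abs mg) h0 hg.
  case: (ointegral mu (fun x => (h x)%:E)) => [a _ _|]; first by exists a.
  by case: (ointegral mu _).
have [P PE] : exists a, ointegral mu (fun x => (p x)%:E) = Fin a.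
  by apply: (fin p f mp p0) => x; rewrite /p ge_max normr_ge0 real_ler_norm ?num_real.
have [N NE] : exists a, ointegral mu (fun x => (n x)%:E) = Fin a.
  apply: (fin n f mn n0) => x.
  by rewrite /n ge_max normr_ge0 -normrN real_ler_norm ?num_real.
have m1 := mE _ (measurable_calL1 f1); have m2 := mE _ (measurable_calL1 f2).
have [F1 F1E] : exists a, ointegral mu (fun x => (f1 x)%:E) = Fin a.
  by apply: (fin f1 f1 m1 f1_0) => x; rewrite real_ler_norm ?num_real.
have [F2 F2E] : exists a, ointegral mu (fun x => (f2 x)%:E) = Fin a.
  by apply: (fin f2 f2 m2 f2_0) => x; rewrite real_ler_norm ?num_real.
have pf2 : (fun x => (p x)%:E + (f2 x)%:E)%E = (fun x => (n x)%:E + (f1 x)%:E)%E.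
  apply/funext => x; rewrite -!EFinD; congr (_%:E).
  have fx : f x = f1 x - f2 x by rewrite fE.
  by rewrite /p /n; case: (leP (f x) 0); case: (leP (- f x) 0) => h1 h2; lra.
have := is_ointegralD p0 f2_0 (is_ointegral_exists mu mp p0) (is_ointegral_exists mu m2 f2_0).
rewrite pf2 => S1.
have := is_ointegralD n0 f1_0 (is_ointegral_exists mu mn n0) (is_ointegral_exists mu m1 f1_0).
move=> /(is_ointegral_unique S1); rewrite PE NE F1E F2E => -[PN].
rewrite /calL1_integral -/(p _) PE NE /=.
by apply/eqP; rewrite subr_eq addrAC -subr_eq opprK PN addrC.
Qed.

End IntegralOfReal.

(* Main.v *)
Require Import Defs.
From HB Require Import structures.
From mathcomp Require Import all_boot all_order all_algebra.
From mathcomp Require Import all_classical all_reals all_analysis measurable_realfun.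
From mathcomp Require Import lra.

(** Why the theorem holds.

    The first half is lattice theory of real functions modulo null sets.
    Because a countable union of null sets is null, a function that is the
    pointwise supremum of countably many integrable functions represents the
    supremum of their classes (L1_class_sup). Applied to two functions this
    makes L1 a vector lattice and the quotient map a lattice homomorphism;
    applied to a sequence below an integrable function, whose pointwise
    supremum is again integrable, it gives sigma-order continuity of the
    quotient map and, after choosing everywhere dominated representatives
    (L1_bounded_repr), sigma-Dedekind completeness of L1.

    The integral of a function that vanishes almost everywhere is 0
    (calL1_integral_null), so the integral descends to L1. If f >= 0 has
    integral 0, then every set where f >= 1/n has measure 0, so f is null: the
    descended integral is strictly positive (calL1_integral_eq0). Its
    sigma-order continuity is the monotone convergence theorem for the order
    integral (ointegral_monotone_convergence), applied to an increasing sequence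
    of representatives.

    The second half is a fact about any strictly positive, sigma-order continuous
    operator T from a sigma-Dedekind complete space L to a monotone complete
    space E with the countable sup property (increasing_net_sup): an increasing
    bounded net x in L has the same supremum as one of its countable subfamilies.
    Indeed T x has a supremum e in E, attained along a sequence of indices, which
    may be taken increasing by directedness; let w be the supremum of x along it,
    so that T w = e up to a constant. If x i were not below w, then following the
    net from i along a larger sequence would produce some w' >= w, w' <> w, again
    with T w' = e, against strict positivity. Dedekind completeness, the
    countable sup property and order continuity of T all follow. *)

Set Implicit Arguments.
Unset Strict Implicit.
Unset Printing Implicit Defensive.

Import Order.TTheory GRing.Theory Num.Theory.
Import numFieldNormedType.Exports HBNNSimple.

Local Open Scope classical_set_scope.
Local Open Scope ring_scope.

(** * Suprema in partially ordered sets and vector spaces *)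

Section SupRange.
Context (disp : Order.disp_t) (L : porderType disp).
Implicit Types (s t z : L).

Local Open Scope order_scope.

Lemma sup_le_ubound (A : set L) s z : supremums A s -> ubound A z -> s <= z.
Proof. by move=> [_]; apply. Qed.

Lemma ubound_supremums (A : set L) s a : supremums A s -> A a -> a <= s.
Proof. by move=> [+ _]; apply. Qed.

Lemma range_ubound (I : Type) (x : I -> L) z :
  (forall i, x i <= z) -> ubound (range x) z.
Proof. by move=> xz _ [i _ <-]. Qed.

Lemma supremums_rangeP (I : Type) (x : I -> L) s :
  (forall i, x i <= s) -> (forall z, (forall i, x i <= z) -> s <= z) ->
  supremums (range x) s.
Proof.
move=> xs sx; split=> [|z xz]; first exact: range_ubound.
by apply: sx => i; apply: xz; exists i.
Qed.

Lemma range_le_sup (I : Type) (x : I -> L) s i : supremums (range x) s -> x i <= s.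
Proof. by move=> /ubound_supremums; apply; exists i. Qed.

Lemma sup_range_le (I : Type) (x : I -> L) s z :
  supremums (range x) s -> (forall i, x i <= z) -> s <= z.
Proof. by move=> xs xz; apply: (sup_le_ubound xs); exact: range_ubound. Qed.

Lemma supremums_unique (A : set L) s t : supremums A s -> supremums A t -> s = t.
Proof. by move=> As At; exact: (is_subset1_supremums As At). Qed.

Lemma range_bool (f : bool -> L) : range f = [set f true; f false].
Proof.
apply/seteqP; split=> [_ [[] _ <-]|_ [->|->]]; by [left|right|exists true|exists false].
Qed.

Lemma sup_incr_seq (x y : nat -> L) s :
  (forall n, x n <= y n) -> (forall n, y n <= s) ->
  supremums (range x) s -> supremums (range y) s.
Proof.
move=> xy ys xs; apply: supremums_rangeP => // z yz.
by apply: (sup_range_le xs) => n; exact: le_trans (yz n).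
Qed.

End SupRange.

Section POVectSup.
Context (R : realType) (L : povectType R).
Implicit Types (s t z : L).

Lemma levN s t : (- s <= - t) = (t <= s).
Proof. by rewrite -[LHS]subv_ge0 opprK addrC subv_ge0. Qed.

Lemma levNl s t : (- s <= t) = (- t <= s).
Proof. by rewrite -[LHS]levN opprK. Qed.

Lemma infimums_rangeN (I : Type) (x : I -> L) s :
  infimums (range x) s <-> supremums (range (fun i => - x i)) (- s).
Proof.
split=> [[xs sx]|xs].
  apply: supremums_rangeP => [i|z xz]; first by rewrite levN; apply: xs; exists i.
  by rewrite levNl; apply: sx => _ [i _ <-]; rewrite levNl.
split=> [_ [i _ <-]|z zx].
  by rewrite -levN; exact: (range_le_sup i xs).
rewrite -levN; apply: (sup_range_le xs) => i; rewrite levN.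
by apply: zx; exists i.
Qed.

Lemma supremums_rangeDr (I : Type) (x : I -> L) s c :
  supremums (range x) s -> supremums (range (fun i => x i + c)) (s + c).
Proof.
move=> xs; apply: supremums_rangeP => [i|z xz].
  exact/lev_add2r/range_le_sup.
rewrite -[c]opprK -lev_subr_addr opprK; apply: (sup_range_le xs) => i.
by rewrite lev_subr_addr.
Qed.

(** Negation reverses the order, so suprema of pairs yield infima of pairs. *)
Lemma vector_lattice_sup :
  (forall s t, supremums [set s; t] !=set0) -> vector_lattice L.
Proof.
move=> sup2 s t; split; first exact: sup2.
have [m sm] := sup2 (- s) (- t); exists (- m).
pose f b := if b then s else t.
have := range_bool f; rewrite /f => <-; apply/infimums_rangeN.
by rewrite opprK range_bool.
Qed.

Lemma net_downN (I : Type) (leI : I -> I -> Prop) (x : I -> L) s :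
  net_down leI x s <-> net_up leI (fun i => - x i) (- s).
Proof.
rewrite /net_down /net_up; split=> -[xd /infimums_rangeN xs]; split => //.
  by move=> i j ij; rewrite levN xd.
by move=> i j ij; rewrite -levN xd.
Qed.



End POVectSup.

(** * Strictly positive operators into monotone complete spaces *)

Section Operators.
Context (R : realType) (L E : povectType R).

Section Positive.
Context (T : L -> E).
Hypothesis Tpos : positive_operator T.

Let TB x y : T (x - y) = T x - T y.
Proof.
pose TL : {linear L -> E} := HB.pack T (GRing.isLinear.Build R L E _ T Tpos.1).
exact: (linearB TL).
Qed.

Let TN x : T (- x) = - T x.
Proof. by rewrite -[- x]sub0r TB -(subrr x) TB subrr sub0r. Qed.

Lemma positive_operator_le x y : x <= y -> T x <= T y.
Proof.
by move=> xy; rewrite -subv_ge0 -TB; apply: Tpos.2; rewrite subv_ge0.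
Qed.

(** Passing from x n to s - x n turns sequences increasing to s into sequences
    decreasing to 0. Continuity below is proved in this form, since pointwise
    suprema and monotone convergence concern increasing sequences. *)
Lemma sigma_order_continuousP : sigma_order_continuous T <->
  forall (x : nat -> L) s, (forall m n, (m <= n)%N -> x m <= x n) ->
    supremums (range x) s -> supremums (range (T \o x)) (T s).
Proof.
split=> [[_ Tx] x s xi xs|Tx].
  have /Tx /net_downN[_] : seq_down (fun n => s - x n) 0.
    apply/net_downN; rewrite oppr0 -(subrr s); split=> [m n mn|].
      by rewrite !opprB; apply/lev_add2r/xi.
    under eq_fun do rewrite opprB; exact: supremums_rangeDr.
  move=> /(supremums_rangeDr (T s)); rewrite oppr0 add0r.
  by under eq_fun do rewrite /= TB opprB subrK.
split=> // x /net_downN[xi xs]; apply/net_downN.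
have /= := Tx _ _ xi xs; rewrite !oppr0 -{1}(subrr 0) TB subrr.
under [fun i => T _]eq_fun do rewrite TN.
split=> // m n mn; rewrite levN; apply: positive_operator_le.
by rewrite -levN; exact: xi.
Qed.

Lemma strictly_positive_inj x y : strictly_positive T ->
  x <= y -> T y <= T x -> x = y.
Proof.
move=> [_ T0] xy Tyx; apply/esym/eqP; rewrite -subr_eq0; apply/eqP/T0.
  by rewrite subv_ge0.
by rewrite TB; apply/eqP; rewrite subr_eq0 eq_le Tyx positive_operator_le.
Qed.

End Positive.

Lemma linear_infimums2 (T : L -> E) : linear T ->
  (forall x y s, supremums [set x; y] s -> supremums [set T x; T y] (T s)) ->
  forall x y s, infimums [set x; y] s -> infimums [set T x; T y] (T s).
Proof.
move=> Tlin Tsup x y s.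
pose TL : {linear L -> E} := HB.pack T (GRing.isLinear.Build R L E _ T Tlin).
have TN u : T (- u) = - T u by exact: (linearN TL).
pose f b := if b then x else y; pose g b := if b then T x else T y.
rewrite -(range_bool f) => /infimums_rangeN; rewrite range_bool => /Tsup.
rewrite !TN => fs; rewrite -(range_bool g); apply/infimums_rangeN; rewrite range_bool /=.
exact: fs.
Qed.

Section StrictlyPositive.
Context (T : L -> E).
Hypotheses (Lsd : sigma_dedekind_complete L) (Emc : monotone_complete E)
  (Ecs : countable_sup_property E).
Hypotheses (Tsp : strictly_positive T) (Tsoc : sigma_order_continuous T).

Let Tpos : positive_operator T := Tsp.1.
Let Tle x y : x <= y -> T x <= T y. Proof. exact: positive_operator_le. Qed.
Let Tsup := (sigma_order_continuousP Tpos).1 Tsoc.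

(** Countable subfamilies of a net are replaced by increasing sequences, because
    sigma-order continuity only speaks of these. *)
Let directed_chain (I : Type) (leI : I -> I -> Prop) (l : nat -> I) (i0 : I) :
  directed leI -> exists k : nat -> I,
    [/\ forall m n, (m <= n)%N -> leI (k m) (k n), forall n, leI (l n) (k n)
      & leI i0 (k 0%N)].
Proof.
move=> [_ leIxx leI_trans dirI].
pose up i j := sval (cid (dirI i j)).
have upl i j : leI i (up i j) by rewrite /up; case: cid => ? [].
have upr i j : leI j (up i j) by rewrite /up; case: cid => ? [].
pose k := fix k n := if n is m.+1 then up (k m) (l m.+1) else up i0 (l 0%N).
exists k; split=> [m n|[|n]|].
- elim: n => [|n IHn]; first by rewrite leqn0 => /eqP ->.
  rewrite leq_eqVlt => /orP[/eqP ->//|]; rewrite ltnS => /IHn mn.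
  exact: leI_trans mn (upl _ _).
- exact: upr.
- exact: upr.
- exact: upl.
Qed.

Let seq_sup (x : nat -> L) z : (forall n, x n <= z) -> supremums (range x) !=set0.
Proof.
move=> xz; apply: Lsd; first by exists (x 0%N), 0%N.
  exact: card_image_le.
by exists z; exact: range_ubound.
Qed.

(** The core of the second half: T and the countable sup property of E select a
    sequence of indices along which T x, hence by strict positivity x itself,
    already reaches its supremum. *)
Lemma increasing_net_sup (I : Type) (leI : I -> I -> Prop) (x : I -> L) :
  directed leI -> (forall i j, leI i j -> x i <= x j) -> has_ubound (range x) ->
  exists (k : nat -> I) (w : L), [/\ forall m n, (m <= n)%N -> leI (k m) (k n),
    supremums (range (x \o k)) w & supremums (range x) w].
Proof.
move=> dirI xi [v xv]; have [[i0] leIxx leI_trans dirI2] := dirI.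
have {}xv i : x i <= v by apply: xv; exists i.
(* The countable sup property only concerns nets of positive elements, so the
   net T x is cut off below i0 and translated by - T (x i0). *)
pose J := {i | leI i0 i}; pose leJ (i j : J) := leI (sval i) (sval j).
have dirJ : directed leJ.
  split=> [|i|i j k|i j]; [by constructor; exists i0|exact: leIxx|exact: leI_trans|].
  have [k [ik jk]] := dirI2 (sval i) (sval j).
  by exists (exist _ k (leI_trans _ _ _ (svalP i) ik)).
pose y (j : J) : E := T (x (sval j)) - T (x i0).
have yi i j : leJ i j -> y i <= y j by move=> ij; apply/lev_add2r/Tle/xi.
have y0 j : 0 <= y j by rewrite subv_ge0; apply/Tle/xi/svalP.
have [|e ye] := Emc dirJ yi.
  by exists (T v - T (x i0)); apply: range_ubound => j; apply/lev_add2r/Tle.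
have e0 : 0 <= e.
  exact: le_trans (y0 (exist _ i0 (leIxx i0))) (range_le_sup _ ye).
have [l yl] := Ecs dirJ y0 e0 (conj yi ye).
(* Sigma-order continuity identifies T w for the supremum w along any
   increasing sequence of indices above l: it does not depend on the sequence. *)
have maxT k w : (forall m n, (m <= n)%N -> leI (k m) (k n)) ->
    (forall n, leI (sval (l n)) (k n)) -> supremums (range (x \o k)) w ->
    T w - T (x i0) = e.
  move=> ki lk kw.
  have xki m n : (m <= n)%N -> (x \o k) m <= (x \o k) n by move=> /ki/xi.
  have /(supremums_rangeDr (- T (x i0))) Tk := Tsup xki kw.
  have ik n : leI i0 (k n) := leI_trans _ _ _ (svalP (l n)) (lk n).
  apply: (supremums_unique Tk).
  apply: sup_incr_seq yl => n; first exact/lev_add2r/Tle/xi.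
  exact: (range_le_sup (exist _ (k n) (ik n)) ye).
have [k [ki lk _]] := directed_chain (sval \o l) i0 dirI.
have [w kw] : supremums (range (x \o k)) !=set0 by apply: (@seq_sup _ v) => n /=.
exists k, w; split=> //; apply: supremums_rangeP => [i|z xz]; last first.
  by apply: (sup_range_le kw) => n /=.
(* To compare x i with w, follow the net along indices above both k and i. *)
have [k' [k'i kk' ik']] := directed_chain k i dirI.
have [w' kw'] : supremums (range (x \o k')) !=set0.
  by apply: (@seq_sup _ v) => n /=.
have ww' : w <= w'.
  apply: (sup_range_le kw) => n; apply: le_trans (range_le_sup n kw').
  exact: xi.
have Tw' : T w' - T (x i0) = e.
  by apply: maxT kw' => // n; exact: leI_trans (lk n) (kk' n).
have Tw : T w = T w' by apply: (addIr (- T (x i0))); rewrite Tw' (maxT k w).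
have -> : w = w' by apply: (strictly_positive_inj Tpos Tsp ww'); rewrite Tw.
by apply: le_trans (range_le_sup 0%N kw'); exact: xi.
Qed.

Lemma strictly_positive_dedekind : vector_lattice L -> dedekind_complete L.
Proof.
move=> Lvl A [a0 Aa0] [v Av].
(* The closure C of A under suprema of pairs has the same upper bounds as A and
   is directed, so it is an increasing net with itself as index set. *)
pose C u := forall B : set L, A `<=` B ->
  (forall s t z, B s -> B t -> supremums [set s; t] z -> B z) -> B u.
have AC u : A u -> C u by move=> Au B + _; exact.
have Cub z : ubound A z -> forall u, C u -> u <= z.
  move=> Az u /(_ [set u | u <= z] Az); apply=> s t y sz tz sty.
  by apply: (sup_le_ubound sty) => _ [->|->].
pose leC (u w : {u | C u}) : Prop := sval u <= sval w.
have dirC : directed leC.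
  split=> [|u|u w y uw wy|u w]; first by constructor; exists a0; exact: AC.
  - exact: lexx.
  - exact: le_trans wy.
  - have [[z uwz] _] := Lvl (sval u) (sval w).
    have Cz : C z.
      move=> B AB Bsup; apply: (Bsup _ _ _ _ _ uwz).
        exact: (svalP u).
      exact: (svalP w).
    by exists (exist _ z Cz); split; apply: (ubound_supremums uwz); [left|right].
have [||k [w [_ _ Cw]]] := @increasing_net_sup _ leC sval dirC.
- by [].
- by exists v; apply: range_ubound => u; exact: Cub (svalP u).
- exists w; split=> [a Aa|z Az].
    exact: (range_le_sup (exist _ a (AC _ Aa)) Cw).
  by apply: (sup_range_le Cw) => u; exact: Cub (svalP u).
Qed.

Lemma strictly_positive_countable_sup : countable_sup_property L.
Proof.
move=> I leI x s dirI _ _ [xi xs].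
have [|k [w [_ kw xw]]] := increasing_net_sup dirI xi; first by exists s; exact: xs.1.
by exists k; rewrite (supremums_unique xs xw).
Qed.

Lemma strictly_positive_order_continuous : order_continuous T.
Proof.
split=> // I leI x dirI /net_downN[xi xs].
have [|k [w [ki kw /(supremums_unique xs) w0]]] := increasing_net_sup dirI xi.
  by exists (- 0); exact: xs.1.
have xd i j : leI i j -> x j <= x i by move=> /xi; rewrite levN.
have /Tsoc.2 [_ Tk] : seq_down (x \o k) 0.
  apply/net_downN; split; last by rewrite w0.
  by move=> m n mn; apply/xi/ki.
have T0 : T 0 = 0.
  by have := Tpos.1 (-1) 0 0; rewrite scaler0 addr0 scaleN1r addNr.
split=> [i j ij|]; first exact/Tle/xd.
split=> [_ [i _ <-]|z zx]; last by apply: Tk.2 => _ [n _ <-]; apply: zx; exists (k n).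
rewrite -T0; apply: Tle; rewrite -levN.
exact: (range_le_sup i xs).
Qed.

End StrictlyPositive.
End Operators.

(** * Null sets of an order measure *)

Section NullSets.
Context d (X : measurableType d) (R : realType) (E : smcVectType R).
Variable mu : omeasure X E.

Lemma omeas_subset_null (A B : set X) : measurable A -> measurable B ->
  A `<=` B -> mu B = 0 -> mu A = 0.
Proof.
move=> mA mB AB B0; apply/le_anti; rewrite omeas_ge0// andbT -B0.
exact: le_omeas.
Qed.

(** Disjointifying the sets leaves every partial sum of measures equal to 0. *)
Lemma omeas_bigcup_null (A : nat -> set X) : (forall n, measurable (A n)) ->
  (forall n, mu (A n) = 0) -> mu (\bigcup_n A n) = 0.
Proof.
move=> mA A0; have mD := seqDU_measurable mA.
have := omeas_sigma_additive mu mD (trivIset_seqDU A).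
rewrite -seqDU_bigcup_eq => supA; apply: (supremums_unique supA).
have D0 n : mu (seqDU A n) = 0.
  exact: omeas_subset_null (mD n) (mA n) (@subset_seqDU _ A n) (A0 n).
by apply: supremums_rangeP => [N|z /(_ 0%N)]; rewrite big1.
Qed.

Lemma almost_everywhere_forall (I : countType) (P : I -> X -> Prop) :
  (forall i, Defs.almost_everywhere mu (P i)) ->
  Defs.almost_everywhere mu (fun x => forall i, P i x).
Proof.
move=> aeP; pose Q n x := if unpickle n is Some i then P i x else True.
have aeQ n : Defs.almost_everywhere mu (Q n).
  by rewrite /Q; case: unpickle => // ; exact: almost_everywhereT.
pose A n := sval (cid (aeQ n)).
have mA n : measurable (A n) by rewrite /A; case: cid => ? [].
have A0 n : mu (A n) = 0 by rewrite /A; case: cid => ? [].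
have QA n x : ~ Q n x -> A n x by rewrite /A; case: cid => B [mB B0 QB]; exact: QB.
exists (\bigcup_n A n); split=> [||x /existsNP[i nPi]].
- exact: bigcup_measurable.
- exact: omeas_bigcup_null.
- by exists (pickle i) => //; apply: QA; rewrite /Q pickleK.
Qed.

Lemma elementary_integral_null (phi : {nnsfun X >-> R}) (A : set X) :
  measurable A -> mu A = 0 -> (forall x, ~ A x -> phi x = 0) ->
  elementary_integral mu phi = 0.
Proof.
move=> mA A0 phiA; rewrite elementary_integral_fibres big1// => c _.
have [->|c0] := eqVneq c 0; first by rewrite ext_scale0.
rewrite (@omeas_subset_null _ A) ?ext_scaler0// => x /= phic.
by apply: contrapT => /phiA phi0; rewrite -phic phi0 eqxx in c0.
Qed.

Lemma elementary_integral_indic (A : set X) (mA : measurable A) :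
  elementary_integral mu (indic_nnsfun R mA) = mu A.
Proof.
rewrite (@elementary_integralE _ _ _ _ mu _ [:: tt] (fun=> 1) (fun=> A))//.
- by rewrite big_seq1 ext_scale1.
- by move=> [] [].
- by move=> i x _ Ax; rewrite /= mindicE mem_set.
- move=> x /(_ tt) nA; rewrite /= mindicE memNset//.
  by apply: nA; rewrite inE.
Qed.

End NullSets.

(** * Lattice structure and countable suprema of the spaces of integrable functions *)

Section CalL1Lattice.
Context d (X : measurableType d) (R : realType) (E : smcVectType R).
Variable mu : omeasure X E.
Implicit Types f g h : calL1 mu.

Lemma calL1_le_at f g x : f <= g -> f x <= g x.
Proof. by move=> /calL1_leP. Qed.

(** Domination by a sum of two integrable functions, rather than by one, covers
    both maxima and functions lying between two integrable ones. *)
Lemma calL1_dominated f g (h : X -> R) : measurable_fun setT h ->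
  (forall x, `|h x| <= `|f x| + `|g x|) -> h \in calL1_pred mu.
Proof.
move=> mh hfg; apply/asboolP; split=> // hoo.
have abs0 (k : X -> R) x : (0 <= (`|k x|)%:E)%E by rewrite lee_fin.
have /asboolP[mf If] := calL1_funP f; have /asboolP[mg Ig] := calL1_funP g.
have Sf := is_ointegral_exists mu (measurable_abs mf) (abs0 f).
have Sg := is_ointegral_exists mu (measurable_abs mg) (abs0 g).
have Sh := is_ointegral_exists mu (measurable_abs mh) (abs0 h).
have S := is_ointegralD (abs0 f) (abs0 g) Sf Sg.
have := is_ointegral_le _ Sh S; rewrite hoo; move: If Ig {Sf Sg S}.
case: (ointegral mu _) => // a _; case: (ointegral mu _) => // b _ le_oo.
suff: false by [].
by apply: le_oo => x; rewrite -EFinD lee_fin.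
Qed.

Lemma calL1_max_subproof f g : (fun x => Num.max (f x) (g x)) \in calL1_pred mu.
Proof.
apply: (@calL1_dominated f g).
  by apply: measurable_maxr; exact: measurable_calL1.
by move=> x /=; case: (leP (f x)) => _; rewrite ?lerDr ?lerDl.
Qed.

Definition calL1_max f g := MkCalL1 (calL1_max_subproof f g).

Lemma calL1_max_pointwise f g x :
  supremums (range (fun b : bool => (if b then f else g) x)) (calL1_max f g x).
Proof.
apply: supremums_rangeP => [[]|z fgz] /=; rewrite ?le_max ?lexx ?orbT//.
by rewrite ge_max (fgz true) (fgz false).
Qed.

Lemma calL1_seq_sup (f : nat -> calL1 mu) g : (forall n x, f n x <= g x) ->
  exists h, forall x, supremums (range (fun n => f n x)) (h x).
Proof.
move=> fg; pose h x := sups (fun n => f n x) 0%N.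
have ubf x : has_ubound (range (fun n => f n x)).
  by exists (g x); exact: range_ubound.
have suph x : supremums (range (fun n => f n x)) (h x).
  have -> : h x = sup (range (fun n => f n x)).
    by congr sup; apply/seteqP; split=> _ [n _ <-]; exists n.
  apply: supremums_rangeP => [n|z fz]; first by apply: ub_le_sup => //; exists n.
  by apply: ge_sup; [exists (f 0%N x), 0%N|exact: range_ubound].
have mh : measurable_fun setT h.
  by apply: measurable_fun_sups => // n; exact: measurable_calL1.
have hL : h \in calL1_pred mu.
  apply: (@calL1_dominated (f 0%N) g) => // x.
  have f0h := range_le_sup 0%N (suph x).
  have hg := sup_range_le (suph x) (fun n => fg n x).
  have := ler_norm (g x); have := ler_norm (- f 0%N x); rewrite normrN.
  have := normr_ge0 (g x); have := normr_ge0 (f 0%N x).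
  by rewrite ler_norml => *; apply/andP; split; lra.
by exists (MkCalL1 hL).
Qed.

Lemma calL1_sup (I : Type) (f : I -> calL1 mu) h :
  (forall x, supremums (range (fun i => f i x)) (h x)) -> supremums (range f) h.
Proof.
move=> fh; apply: supremums_rangeP => [i|z fz]; apply/calL1_leP => x.
  exact: (range_le_sup i (fh x)).
by apply: (sup_range_le (fh x)) => i; have /calL1_leP := fz i.
Qed.

(** The order of L1 is defined through positive representatives; if f <= g almost
    everywhere, then the positive part of g - f is such a representative. *)
Lemma L1_class_leP f g :
  L1_class f <= L1_class g <-> Defs.almost_everywhere mu (fun x => f x <= g x).
Proof.
split=> [/asboolP[p p0 pE]|fg].
  have /L1_class_eq/asboolP[_] : L1_class p = L1_class (g - f) by rewrite linearB.
  apply: almost_everywhere_subset => x.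
  rewrite -[_ x]/(p x - (g x - f x)) => /eqP; rewrite subr_eq0 => /eqP px.
  by rewrite -subr_ge0 -px; exact: calL1_le_at p0.
apply/asboolP; exists (calL1_max (g - f) 0).
  by apply/calL1_leP => x /=; rewrite le_max lexx orbT.
rewrite -linearB; apply/L1_class_eq/asboolP; split; first exact: measurable_calL1.
apply: almost_everywhere_subset fg => x fgx.
rewrite -[LHS]/(Num.max (g x - f x) 0 - (g x - f x)).
by rewrite max_l ?subrr// subr_ge0.
Qed.

(** A countable union of null sets is null, so almost everywhere upper bounds
    of a countable family are simultaneous. *)
Lemma L1_class_sup (I : countType) (f : I -> calL1 mu) h :
  (forall x, supremums (range (fun i => f i x)) (h x)) ->
  supremums (range (fun i => L1_class (f i))) (L1_class h).
Proof.
move=> fh; apply: supremums_rangeP => [i|z].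
  apply/L1_class_leP; apply: almost_everywhereT => x.
  exact: (range_le_sup i (fh x)).
rewrite -[z]L1_classK => fz; apply/L1_class_leP.
have /almost_everywhere_forall := fun i => (L1_class_leP _ _).1 (fz i).
by apply: almost_everywhere_subset => x; exact: sup_range_le.
Qed.

Lemma L1_class_max f g :
  supremums [set L1_class f; L1_class g] (L1_class (calL1_max f g)).
Proof.
by have := L1_class_sup (calL1_max_pointwise f g); rewrite range_bool.
Qed.

Lemma calL1_max_sup f g : supremums [set f; g] (calL1_max f g).
Proof. by have := calL1_sup (calL1_max_pointwise f g); rewrite range_bool. Qed.

Lemma calL1_vector_lattice : vector_lattice (calL1 mu).
Proof.
by apply: vector_lattice_sup => f g; exists (calL1_max f g); exact: calL1_max_sup.
Qed.

Lemma L1_vector_lattice : vector_lattice (L1 mu).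
Proof.
apply: vector_lattice_sup => u v; rewrite -[u]L1_classK -[v]L1_classK.
by exists (L1_class (calL1_max (repr u) (repr v))); exact: L1_class_max.
Qed.

Lemma L1_class_lattice_hom : vector_lattice_hom (@L1_class d X R E mu).
Proof.
have sup2 f g h : supremums [set f; g] h ->
    supremums [set L1_class f; L1_class g] (L1_class h).
  move=> fgh; rewrite (supremums_unique fgh (calL1_max_sup f g)).
  exact: L1_class_max.
split=> //.
- exact: calL1_vector_lattice.
- exact: L1_vector_lattice.
- exact: L1_class_linear.
- exact: linear_infimums2 (@L1_class_linear d X R E mu) sup2.
Qed.

Lemma L1_class_positive : positive_operator (@L1_class d X R E mu).
Proof.
split=> [|f f0]; first exact: L1_class_linear.
by apply/asboolP; exists f => //; rewrite subr0.
Qed.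

Lemma L1_class_sigma_order_continuous :
  sigma_order_continuous (@L1_class d X R E mu).
Proof.
apply/sigma_order_continuousP => [|f h _ fh]; first exact: L1_class_positive.
have fh' n x : f n x <= h x by exact: calL1_le_at _ (range_le_sup n fh).
have [s fs] := calL1_seq_sup fh'.
by rewrite (supremums_unique fh (calL1_sup fs)); exact: L1_class_sup.
Qed.

(** Representatives of a dominated sequence can be chosen so that they are
    dominated everywhere: the positive cone of L1 is the image of the positive
    cone of calL1, so v - u n has a representative that is positive everywhere. *)
Lemma L1_bounded_repr (u : nat -> L1 mu) v : (forall n, u n <= v) ->
  exists (f : nat -> calL1 mu) g,
    [/\ forall n, L1_class (f n) = u n, L1_class g = v & forall n x, f n x <= g x].
Proof.
move=> uv; have /choice[p pE] n : exists p, 0 <= p /\ L1_class p = v - u n.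
  by have /asboolP[p] := uv n; exists p.
exists (fun n => repr v - p n), (repr v); split=> [n||n x].
- by rewrite linearB /= L1_classK (pE n).2 opprB addrC subrK.
- exact: L1_classK.
- by rewrite -[leLHS]/(repr v x - p n x) gerBl; exact: calL1_le_at _ (pE n).1.
Qed.

Lemma L1_sigma_dedekind : sigma_dedekind_complete (L1 mu).
Proof.
move=> A A0 cA [v Av].
have [AE|[surj_u]] := pfcard_geP cA; first by move: A0; rewrite AE => -[].
have [u uA] : exists u : nat -> L1 mu, A = range u.
  by exists surj_u; apply/esym/image_eq.
have uv n : u n <= v by apply: Av; rewrite uA; exists n.
have [f [g [fu _ fg]]] := L1_bounded_repr uv.
have [h fh] := calL1_seq_sup fg; exists (L1_class h).
by rewrite uA; under eq_fun do rewrite -fu; exact: L1_class_sup.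
Qed.

End CalL1Lattice.

(** * Linearity and kernel of the order integral *)

Section Integral.
Context d (X : measurableType d) (R : realType) (E : smcVectType R).
Variable mu : omeasure X E.
Implicit Types f g h : calL1 mu.

Lemma supremums_Fin (I : Type) (x : I -> E) s :
  supremums (range (fun i => Fin (x i))) (Fin s) -> supremums (range x) s.
Proof.
move=> xs; apply: supremums_rangeP => [i|z xz].
  by rewrite -ext_finE; exact: range_le_sup i xs.
by rewrite -ext_finE; apply: (sup_range_le xs).
Qed.

Lemma calL1_ge0_EFin f : 0 <= f -> forall x, (0 <= (f x)%:E)%E.
Proof. by move=> f0 x; rewrite lee_fin; exact: calL1_le_at f0. Qed.

Lemma measurable_calL1_EFin f : measurable_fun setT (fun x => (f x)%:E).
Proof. exact/measurable_EFinP/measurable_calL1. Qed.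

(** On positive functions the E-valued integral is the extended one; this
    transfers the additivity and monotonicity of the latter. *)
Lemma is_ointegral_calL1 f : 0 <= f ->
  is_ointegral mu (fun x => (f x)%:E) (Fin (calL1_integral f)).
Proof.
move=> f0; have f0E := calL1_ge0_EFin f0.
suff -> : Fin (calL1_integral f) = ointegral mu (fun x => (f x)%:E).
  exact: is_ointegral_exists (measurable_calL1_EFin f) f0E.
have /asboolP[_ fin] := calL1_funP f.
rewrite (calL1_integralE f0 (lexx 0)) ?subr0//.
have -> : ointegral mu (fun x => ((0 : calL1 mu) x)%:E) = 0.
  rewrite (ointegralE (is_ointegral_nnsfun mu nnsfun0)).
  exact: (elementary_integral_null measurable0 (omeas0 mu)).
rewrite subr0 ext_finK//; congr (_ <> _) : fin; congr ointegral.
by apply/funext => x; rewrite ger0_norm//; exact: calL1_le_at f0.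
Qed.

Lemma calL1_integral_ge0 f : 0 <= f -> 0 <= calL1_integral f.
Proof.
move=> f0; have [phi [_ _ supI]] := is_ointegral_calL1 f0.
rewrite -ext_finE; apply: le_trans (range_le_sup 0%N supI).
exact: elementary_integral_ge0.
Qed.

Lemma calL1_add_ge0 f g : 0 <= f -> 0 <= g -> 0 <= f + g.
Proof. by move=> f0 g0; apply: le_trans g0 _; exact: calL1_le_addl. Qed.

Lemma calL1_integralD_ge0 f g : 0 <= f -> 0 <= g ->
  calL1_integral (f + g) = calL1_integral f + calL1_integral g.
Proof.
move=> f0 g0; have fg0 := calL1_add_ge0 f0 g0.
have S := is_ointegralD (calL1_ge0_EFin f0) (calL1_ge0_EFin g0)
  (is_ointegral_calL1 f0) (is_ointegral_calL1 g0).
by have [] := is_ointegral_unique (is_ointegral_calL1 fg0) S.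
Qed.

Lemma calL1_integralZ_ge0 (k : R) f : 0 <= k -> 0 <= f ->
  calL1_integral (k *: f) = k *: calL1_integral f.
Proof.
move=> k0 f0; have kf0 : 0 <= k *: f by exact: scalev_ge0.
have S := is_ointegralZ k0 (is_ointegral_calL1 f0).
by have [] := is_ointegral_unique (is_ointegral_calL1 kf0) S.
Qed.

Lemma calL1_integralB_ge0 f g : 0 <= f -> 0 <= g ->
  calL1_integral (f - g) = calL1_integral f - calL1_integral g.
Proof.
move=> f0 g0; rewrite (calL1_integralE f0 g0 erefl).
by rewrite (ointegralE (is_ointegral_calL1 f0)) (ointegralE (is_ointegral_calL1 g0)).
Qed.

Lemma calL1_max_ge0 f : 0 <= calL1_max f 0.
Proof. by apply/calL1_leP => x /=; rewrite le_max lexx orbT. Qed.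

Lemma calL1_decomp f : f = calL1_max f 0 - calL1_max (- f) 0.
Proof.
apply/val_inj/funext => x.
rewrite -[RHS]/(Num.max (f x) 0 - Num.max (- f x) 0) /=.
by case: (leP (f x) 0) => fx; case: (leP (- f x) 0) => fx'; lra.
Qed.

(** Writing functions as differences of positive ones reduces linearity to
    additivity and positive homogeneity on the positive cone. *)
Lemma calL1_integral_linear : linear (@calL1_integral d X R E mu).
Proof.
have addI f g : calL1_integral (f + g) = calL1_integral f + calL1_integral g.
  have D p q p' q' : (p - q) + (p' - q') = (p + p') - (q + q') :> calL1 mu.
    by rewrite opprD addrACA.
  rewrite (calL1_decomp f) (calL1_decomp g) D !calL1_integralB_ge0 ?calL1_max_ge0//.
  - rewrite !calL1_integralD_ge0 ?calL1_max_ge0// opprD; exact: addrACA.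
  - by apply: calL1_add_ge0; exact: calL1_max_ge0.
  - by apply: calL1_add_ge0; exact: calL1_max_ge0.
have oppI f : calL1_integral (- f) = - calL1_integral f.
  rewrite (calL1_decomp f) opprB !calL1_integralB_ge0 ?calL1_max_ge0//.
  exact/esym/opprB.
have scaleI (k : R) f : 0 <= k -> calL1_integral (k *: f) = k *: calL1_integral f.
  move=> k0; rewrite (calL1_decomp f) scalerBr !calL1_integralB_ge0 ?calL1_max_ge0//.
  - by rewrite !calL1_integralZ_ge0 ?calL1_max_ge0// -scalerBr.
  - by rewrite scalev_ge0 ?calL1_max_ge0.
  - by rewrite scalev_ge0 ?calL1_max_ge0.
move=> k f g; rewrite addI; congr (_ + _).
have [k0|k0] := leP 0 k; first exact: scaleI.
by rewrite -[k]opprK scaleNr oppI scaleI ?scaleNr// oppr_ge0 ltW.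
Qed.

(** Every elementary function below f vanishes off a fixed set of measure 0. *)
Lemma calL1_integral_null_ge0 f : 0 <= f -> calL1_null f -> calL1_integral f = 0.
Proof.
move=> f0 /asboolP[_ [A [mA A0 fA]]].
have [phi [phi_nd phif supI]] := is_ointegral_calL1 f0.
have phi0 n : elementary_integral mu (phi n) = 0.
  apply: (elementary_integral_null mA A0) => x nAx.
  have fx0 : f x = 0 by apply: contrapT => /fA.
  apply/eqP; rewrite eq_le fun_ge0 andbT -lee_fin -fx0.
  apply: (cvge_ge _ (phif x)); exists n => // m /= nm.
  by rewrite lee_fin; exact: phi_nd.
suff [] : Fin (calL1_integral f) = 0 by [].
apply: (supremums_unique supI).
by apply: supremums_rangeP => [n|z /(_ 0%N)]; rewrite ?phi0.
Qed.

Lemma calL1_integral_null f : calL1_null f -> calL1_integral f = 0.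
Proof.
move=> nf; have /asboolP[_ aef] := nf.
have null_pos g : calL1_null g -> calL1_integral (calL1_max g 0) = 0.
  move=> /asboolP[_ g0]; apply: calL1_integral_null_ge0; first exact: calL1_max_ge0.
  apply/asboolP; split; first exact: measurable_calL1.
  by apply: almost_everywhere_subset g0 => x /= ->; rewrite maxxx.
rewrite (calL1_decomp f) calL1_integralB_ge0 ?calL1_max_ge0// !null_pos ?subrr//.
apply/asboolP; split; first exact: measurable_calL1.
by apply: almost_everywhere_subset aef => x fx0; rewrite -[LHS]/(- f x) fx0 oppr0.
Qed.

(** Chebyshev's inequality: the measure of the set where f >= 1/(n+1) is at most
    n+1 times the integral of f. *)
Lemma calL1_integral_eq0 f : 0 <= f -> calL1_integral f = 0 -> calL1_null f.
Proof.
move=> f0 If0; apply/asboolP; split; first exact: measurable_calL1.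
pose A n := [set x | n.+1%:R^-1 <= f x].
have mA n : measurable (A n).
  rewrite -[A n]setTI; apply: measurable_fun_le => //.
  exact: measurable_calL1.
have A0 n : mu (A n) = 0.
  have c0 : 0 <= n.+1%:R^-1 :> R by rewrite invr_ge0.
  have := elementary_integral_indic mu (mA n).
  pose phi := scale_nnsfun (indic_nnsfun R (mA n)) c0.
  have phif x : ((phi x)%:E <= (f x)%:E)%E.
    rewrite lee_fin /= mindicE.
    have [/set_mem|_] := boolP (x \in A n); first by rewrite mulr1.
    by rewrite mulr0; exact: calL1_le_at f0.
  have := is_ointegral_le phif (is_ointegral_nnsfun mu phi) (is_ointegral_calL1 f0).
  rewrite (elementary_integralZ mu (phi := indic_nnsfun R (mA n)) (k := n.+1%:R^-1))//.
  rewrite elementary_integral_indic If0 => le0 _; apply/le_anti.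
  rewrite omeas_ge0// andbT -[leLHS]ext_scale1 -(@mulfV _ n.+1%:R)//.
  rewrite -ext_scaleA -[leRHS](ext_scaler0 E n.+1%:R).
  by apply: ext_scale_le => //; exact: le0.
exists (\bigcup_n A n); split=> [||x fx0].
- exact: bigcup_measurable.
- exact: omeas_bigcup_null.
- have fx : 0 < f x by rewrite lt_def (calL1_le_at _ f0) andbT; exact/eqP.
  by exists (Num.truncn (f x)^-1) => //=; rewrite /A /= invf_ple ?posrE// ltW// truncnS_gt.
Qed.

End Integral.

(** * Monotone convergence *)

Section MonotoneConvergence.
Context d (X : measurableType d) (R : realType) (E : smcVectType R).
Variable mu : omeasure X E.

(** Let phi n k increase to f n as k grows. The maxima of phi 0 k, ..., phi k k
    are elementary, increase with k, lie below f k, and eventually exceed every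
    value below h; so the integral of an elementary function below h is at most
    the supremum of their integrals. *)
Lemma ointegral_monotone_convergence (f : nat -> X -> \bar R) (h : X -> \bar R) :
  (forall n, measurable_fun setT (f n)) -> measurable_fun setT h ->
  (forall n x, (0 <= f n x)%E) ->
  (forall x m n, (m <= n)%N -> (f m x <= f n x)%E) ->
  (forall x, supremums (range (fun n => f n x)) (h x)) ->
  supremums (range (fun n => ointegral mu (f n))) (ointegral mu h).
Proof.
move=> mf mh f0 f_nd fh; have fleh n x : (f n x <= h x)%E.
  exact: (range_le_sup n (fh x)).
have Sf n := is_ointegral_exists mu (mf n) (f0 n).
have Sh := is_ointegral_exists mu mh (fun x => le_trans (f0 0%N x) (fleh 0%N x)).
apply: supremums_rangeP => [n|v fv]; first exact: is_ointegral_le (fleh n) (Sf n) Sh.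
have /choice[phi phiP] n := approximation measurableT (mf n) (fun x _ => f0 n x).
have phi_nd n x k l : (k <= l)%N -> phi n k x <= phi n l x.
  by move=> kl; have [/(_ k l kl)/lefP + _] := phiP n; exact.
have phi_f n x : (phi n k x)%:E @[k --> \oo] --> f n x by exact: (phiP n).2.
have phi_le n k x : ((phi n k x)%:E <= f n x)%E.
  apply: (cvge_ge _ (phi_f n x)); exists k => // l /= kl.
  by rewrite lee_fin; exact: phi_nd.
pose g k := bigmax_nnsfun (fun n => phi n k) k.+1.
have phi_g n k x : (n <= k)%N -> phi n k x <= g k x.
  rewrite -ltnS => nk; rewrite bigmax_nnsfunE.
  exact: (le_bigmax _ (fun i : 'I_k.+1 => phi i k x) (Ordinal nk)).
have g_nd x : {homo (fun k => g k x) : k l / (k <= l)%N >-> k <= l}.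
  move=> k l kl; rewrite [leLHS]bigmax_nnsfunE; apply/bigmax_leP; split=> [|i _].
    exact: fun_ge0.
  apply: le_trans (phi_nd _ _ _ _ kl) (phi_g _ _ _ _).
  by rewrite (leq_trans _ kl)// -ltnS.
have g_le k x : ((g k x)%:E <= f k x)%E.
  rewrite bigmax_nnsfunE; elim/big_ind: _ => [|a b|i _]; first exact: f0.
    by case: (leP a b).
  by apply: le_trans (phi_le _ _ _) (f_nd _ _ _ _); rewrite -ltnS.
have [psi [psi_nd psi_h supI]] := Sh.
apply: (sup_range_le supI) => n; apply: (le_elementary_integral_sup g_nd).
  move=> x c cpsi; apply: contrapT => /forallNP gc.
  have : (h x <= c%:E)%E.
    apply: (sup_range_le (fh x)) => i; apply: (cvge_le _ (phi_f i x)).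
    exists i => // k /= ik; rewrite lee_fin (le_trans (phi_g _ _ x ik))// leNgt.
    exact/negP.
  apply/negP; rewrite -ltNge (@lt_le_trans _ _ (psi n x)%:E) ?lte_fin//.
  apply: (cvge_ge _ (psi_h x)); exists n => // m /= nm.
  by rewrite lee_fin; exact: psi_nd.
apply: range_ubound => k; apply: le_trans (fv k).
exact: is_ointegral_le (g_le k) (is_ointegral_nnsfun mu (g k)) (Sf k).
Qed.

Lemma supremums_EFin (x : nat -> R) s :
  supremums (range x) s -> supremums (range (fun n => (x n)%:E)) s%:E.
Proof.
move=> xs; apply: supremums_rangeP => [n|[z| |] xz].
- by rewrite lee_fin; exact: range_le_sup n xs.
- by rewrite lee_fin; apply: (sup_range_le xs) => n; rewrite -lee_fin.
- exact: leey.
- by have := xz 0%N.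
Qed.

(** Subtracting the first term reduces to positive functions. *)
Lemma calL1_monotone_convergence (f : nat -> calL1 mu) (h : calL1 mu) :
  (forall x m n, (m <= n)%N -> f m x <= f n x) ->
  (forall x, supremums (range (fun n => f n x)) (h x)) ->
  supremums (range (fun n => calL1_integral (f n))) (calL1_integral h).
Proof.
move=> f_nd fh; have fn0 n : 0 <= f n - f 0%N.
  by apply/calL1_leP => x; rewrite -[leRHS]/(f n x - f 0%N x) subr_ge0 f_nd.
have h0 : 0 <= h - f 0%N.
  apply/calL1_leP => x; rewrite -[leRHS]/(h x - f 0%N x) subr_ge0.
  exact: range_le_sup (fh x).
have : supremums (range (fun n => ointegral mu (fun x => ((f n - f 0%N) x)%:E)))
    (ointegral mu (fun x => ((h - f 0%N) x)%:E)).
  apply: ointegral_monotone_convergence => [n||n x|x m n mn|x].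
  - exact: measurable_calL1_EFin.
  - exact: measurable_calL1_EFin.
  - exact: calL1_ge0_EFin.
  - by rewrite lee_fin; apply: lerD => //; exact: f_nd.
  - apply: supremums_EFin; apply: supremums_rangeP => [n|z fz].
      exact: lerD (range_le_sup n (fh x)) (lexx _).
    rewrite -[leLHS]/(h x - f 0%N x) lerBlDr.
    by apply: (sup_range_le (fh x)) => n; rewrite -lerBlDr; exact: fz.
under eq_fun do rewrite (ointegralE (is_ointegral_calL1 (fn0 _))).
rewrite (ointegralE (is_ointegral_calL1 h0)) => /supremums_Fin.
move=> /(supremums_rangeDr (calL1_integral (f 0%N))).
have IB (p q : calL1 mu) : calL1_integral (p - q) + calL1_integral q = calL1_integral p.
  by have := calL1_integral_linear 1 (p - q) q; rewrite !scale1r subrK.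
by under eq_fun do rewrite IB; rewrite IB.
Qed.

End MonotoneConvergence.

(** * The integral on the quotient *)

Section L1Integral.
Context d (X : measurableType d) (R : realType) (E : smcVectType R).
Variable mu : omeasure X E.

Definition L1_integral (u : L1 mu) : E := calL1_integral (repr u).

Lemma L1_integral_class (f : calL1 mu) : L1_integral (L1_class f) = calL1_integral f.
Proof.
have /L1_class_eq nf : L1_class f = L1_class (repr (L1_class f)).
  by rewrite L1_classK.
have := calL1_integral_linear 1 (f - repr (L1_class f)) (repr (L1_class f)).
by rewrite !scale1r subrK (calL1_integral_null nf) add0r => ->.
Qed.

Lemma L1_integral_linear : linear L1_integral.
Proof.
move=> k u v; rewrite -[u]L1_classK -[v]L1_classK -L1_class_linear.
by rewrite !L1_integral_class calL1_integral_linear.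
Qed.

Lemma L1_integral_strictly_positive : strictly_positive L1_integral.
Proof.
split=> [|u /asboolP[f f0]]; last rewrite subr0 => <-.
  split=> [|u /asboolP[f f0]]; first exact: L1_integral_linear.
  by rewrite subr0 => <-; rewrite L1_integral_class calL1_integral_ge0.
rewrite L1_integral_class => /(calL1_integral_eq0 f0) nf.
by rewrite -(linear0 (@L1_class d X R E mu)); apply/L1_class_eq; rewrite subr0.
Qed.

(** Running maxima of dominated representatives: since u increases, they
    represent the same classes. *)
Lemma L1_increasing_repr (u : nat -> L1 mu) v :
  (forall m n, (m <= n)%N -> u m <= u n) -> (forall n, u n <= v) ->
  exists (f : nat -> calL1 mu) (g : calL1 mu),
    [/\ forall n, L1_class (f n) = u n, forall n x, f n x <= g x
      & forall x m n, (m <= n)%N -> f m x <= f n x].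
Proof.
move=> u_nd /L1_bounded_repr[f [g [fu _ fg]]].
pose F := fix F n := if n is m.+1 then calL1_max (F m) (f m.+1) else f 0%N.
exists F, g; split=> [|n x|x].
- elim=> [|n IHn]; first exact: fu.
  have := L1_class_max (F n) (f n.+1); rewrite IHn fu => maxu.
  apply: (supremums_unique maxu); split=> [_ [->|->]|z uz]; first exact: u_nd.
    exact: lexx.
  by have := uz (u n.+1); apply; right.
- by elim: n => [|n IHn] /=; [exact: fg|rewrite ge_max IHn fg].
- apply: (@homo_leq R (fun n => F n x) (fun a b => a <= b)) => [a|b a c|n].
  + exact: lexx.
  + exact: le_trans.
  + by rewrite /= le_max lexx.
Qed.

Lemma L1_integral_sigma_order_continuous : sigma_order_continuous L1_integral.
Proof.
apply/sigma_order_continuousP; first exact: L1_integral_strictly_positive.1.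
move=> u v u_nd uv; have u_le n := range_le_sup n uv.
have [f [g [fu fg f_nd]]] := L1_increasing_repr u_nd u_le.
have [h fh] := calL1_seq_sup fg.
have hv : L1_class h = v.
  by have := L1_class_sup fh; under eq_fun do rewrite fu; move/supremums_unique; apply.
rewrite -hv L1_integral_class /comp.
under eq_fun do rewrite -fu L1_integral_class.
exact: calL1_monotone_convergence.
Qed.

End L1Integral.

Theorem theorem6p17 (R : realType) (d : measure_display) (X : measurableType d)
    (E : smcVectType R) (mu : omeasure X E) :
  [/\ sigma_order_continuous (@L1_class d X R E mu),
      vector_lattice_hom (@L1_class d X R E mu),
      vector_lattice (L1 mu)
    & sigma_dedekind_complete (L1 mu)] /\
  exists I_mu : L1 mu -> E,
    [/\ forall f : calL1 mu, I_mu (L1_class f) = calL1_integral f,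
        linear I_mu,
        strictly_positive I_mu
      & sigma_order_continuous I_mu] /\
    (monotone_complete E -> countable_sup_property E ->
      [/\ vector_lattice (L1 mu),
          dedekind_complete (L1 mu),
          countable_sup_property (L1 mu)
        & order_continuous I_mu]).
Proof.
have Lsd := @L1_sigma_dedekind d X R E mu.
have Lvl := @L1_vector_lattice d X R E mu.
have Isp := L1_integral_strictly_positive mu.
have Isoc := L1_integral_sigma_order_continuous mu.
split.
  split=> //; first exact: L1_class_sigma_order_continuous.
  exact: L1_class_lattice_hom.
exists (@L1_integral d X R E mu); split=> [|Emc Ecs].
  by split=> //; [exact: L1_integral_class|exact: L1_integral_linear].
split=> //.
- exact: strictly_positive_dedekind Lsd Emc Ecs Isp Isoc Lvl.
- exact: strictly_positive_countable_sup Lsd Emc Ecs Isp Isoc.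
- exact: strictly_positive_order_continuous Lsd Emc Ecs Isp Isoc.
Qed.
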